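(* There exist a fixed nonempty finite family $\mathcal L$ of graphs, a constant $c>0$, and an integer $N$ such that $p(\mathcal L)=3$ and, for every $n\geq N$, \[ \operatorname{ex}(n,\mathcal L)>t_3(n)+c\,n^{3/2}, \] whereas every $G\in\operatorname{EX}(n,\mathcal L)$ satisfies \[ \kappa(\overline G)\leq 2 . \] In particular, no $\mathcal L$-extremal graph of sufficiently large order is a complete join of three graphs of positive order.
   Context: All graphs are finite and simple and are considered up to isomorphism; containment means ordinary (not necessarily induced) subgraph containment. For a nonempty family $\mathcal F$ of graphs, a graph is $\mathcal F$-free if it contains no member of $\mathcal F$ as a subgraph; $\operatorname{ex}(n,\mathcal F)$ is the maximum number of edges in an $n$-vertex $\mathcal F$-free graph, and $\operatorname{EX}(n,\mathcal F)$ is the set of $n$-vertex $\mathcal F$-free graphs with exactly $\operatorname{ex}(n,\mathcal F)$ edges (the $\mathcal F$-extremal graphs). Put $p(\mathcal F)=\min_{F\in\mathcal F}\chi(F)-1$, where $\chi$ is the chromatic number. $t_r(n)$ is the number of edges of the balanced complete $r$-partite graph on $n$ vertices (the Turán graph). $\overline G$ is the complement of $G$, and $\kappa(H)$ is the number of connected components of $H$. The complete join $G_1\otimes\cdots\otimes G_r$ of vertex-disjoint graphs is obtained from their disjoint union by adding every edge between distinct factors. *)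

(* Defs.v *)
From HB Require Import structures.
From mathcomp Require Import all_boot.
Set Implicit Arguments.
Unset Strict Implicit.
Unset Printing Implicit Defensive.

(* A finite simple graph with vertex set V is a set of 2-element subsets of V,
   so that [sgraph V] is itself a finite type. *)
Record sgraph (V : finType) := SGraph {
  edges :> {set {set V}};
  edges_card2 : [forall e in edges, #|e| == 2] }.

HB.instance Definition _ (V : finType) := [isSub for @edges V].
HB.instance Definition _ (V : finType) := [Finite of sgraph V by <:].

Definition adj (V : finType) (G : sgraph V) : rel V :=
  fun x y => [set x; y] \in edges G.

Lemma adj_sym (V : finType) (G : sgraph V) : symmetric (adj G).
Proof. by move=> x y; rewrite /adj setUC. Qed.

Lemma adj_irrefl (V : finType) (G : sgraph V) : irreflexive (adj G).
Proof.
move=> x; rewrite /adj setUid; apply/negP => xG.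
by have /forall_inP/(_ _ xG) := edges_card2 G; rewrite cards1.
Qed.

Definition edge_set_of (V : finType) (r : rel V) : {set {set V}} :=
  [set e | [exists x, exists y, [&& x != y, r x y & e == [set x; y]]]].

Lemma edge_set_of_card2 (V : finType) (r : rel V) :
  [forall e in edge_set_of r, #|e| == 2].
Proof.
apply/forall_inP => e; rewrite inE.
by move=> /existsP[x /existsP[y /and3P[xy _ /eqP->]]]; rewrite cards2 xy.
Qed.

(* All relations to which [graph_of] is applied below are symmetric; loops are
   discarded. *)
Definition graph_of (V : finType) (r : rel V) : sgraph V :=
  SGraph (edge_set_of_card2 r).

Lemma adj_graph_of (V : finType) (r : rel V) : symmetric r ->
  forall x y, adj (graph_of r) x y = (x != y) && r x y.
Proof.
move=> rC x y; rewrite /adj inE; apply/existsP/andP; last first.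
  by move=> [xy rxy]; exists x; apply/existsP; exists y; rewrite xy rxy eqxx.
move=> [u /existsP[v /and3P[uv ruv /eqP E]]].
have xy : x != y.
  apply: contraNneq uv => Exy; move: E; rewrite Exy setUid => E.
  have /set1P-> : u \in [set y] by rewrite E !inE eqxx.
  have /set1P-> : v \in [set y] by rewrite E !inE eqxx orbT.
  by [].
have: x \in [set u; v] by rewrite -E !inE eqxx.
have: y \in [set u; v] by rewrite -E !inE eqxx orbT.
rewrite !inE => /orP[]/eqP Ey /orP[]/eqP Ex; move: xy ruv; rewrite Ex Ey ?eqxx //.
by rewrite rC.
Qed.

Record graph := Graph { vertex : finType; sgraph_of : sgraph vertex }.

Definition contains (V W : finType) (G : sgraph V) (F : sgraph W) : bool :=
  [exists f : {ffun W -> V},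
    injectiveb f && [forall x, forall y, adj F x y ==> adj G (f x) (f y)]].

Definition isomorphic (V W : finType) (G : sgraph V) (H : sgraph W) : Prop :=
  exists f : V -> W, bijective f /\ forall x y, adj G x y = adj H (f x) (f y).

Definition is_free (L : seq graph) (V : finType) (G : sgraph V) : bool :=
  all (fun F => ~~ contains G (sgraph_of F)) L.

(* Graphs being considered up to isomorphism, the n-vertex graphs are
   represented by the graphs with vertex set 'I_n. *)
Definition ex_num (n : nat) (L : seq graph) : nat :=
  \max_(G : sgraph 'I_n | is_free L G) #|edges G|.

Definition EX (n : nat) (L : seq graph) : {set sgraph 'I_n} :=
  [set G | is_free L G & #|edges G| == ex_num n L].

Definition colorable (V : finType) (G : sgraph V) (k : nat) : bool :=
  [exists c : {ffun V -> 'I_k},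
    [forall x, forall y, adj G x y ==> (c x != c y)]].

Lemma colorable_ex (V : finType) (G : sgraph V) : exists k, colorable G k.
Proof.
exists #|V|; apply/existsP; exists [ffun x => enum_rank x].
apply/forallP => x; apply/forallP => y; apply/implyP => xy.
rewrite !ffunE (inj_eq enum_rank_inj).
by apply: contraTneq xy => ->; rewrite adj_irrefl.
Qed.

Definition chromatic_number (V : finType) (G : sgraph V) : nat :=
  ex_minn (colorable_ex G).

(* The unit of the iterated minimum is one of its terms, so for a nonempty list
   this is the least element. *)
Definition min_seq (s : seq nat) : nat := \big[minn/head 0 s]_(k <- s) k.

Definition p_family (L : seq graph) : nat :=
  min_seq [seq chromatic_number (sgraph_of F) | F <- L] - 1.

(* The parts are the residue classes modulo r. *)
Definition turan_graph (r n : nat) : sgraph 'I_n :=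
  graph_of (fun x y : 'I_n => x %% r != y %% r).

Definition turan (r n : nat) : nat := #|edges (turan_graph r n)|.

Definition compl_graph (V : finType) (G : sgraph V) : sgraph V :=
  graph_of (fun x y => ~~ adj G x y).

Definition num_components (V : finType) (G : sgraph V) : nat :=
  n_comp (adj G) V.

(* On the disjoint union {i & V i} of the vertex sets: two vertices with the
   same tag are adjacent iff they are adjacent in that factor. *)
Definition complete_join (I : finType) (V : I -> finType)
    (G : forall i, sgraph (V i)) : sgraph {i : I & V i} :=
  graph_of (fun u v : {i : I & V i} =>
    (tag u != tag v) || adj (G (tag u)) (tagged u) (tagged_as u v)).

(* Main.v *)
Require Import Defs.
From mathcomp Require Import all_boot all_fingroup all_order all_algebra finfield.
From mathcomp Require Import reals exp.
From mathcomp Require Import zify ring lra.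
Set Implicit Arguments.
Unset Strict Implicit.
Unset Printing Implicit Defensive.
Import Order.TTheory GRing.Theory Num.Theory.

(* In the competing graphs one part A carries a C_3- and C_4-free graph
   with about n^(3/2) edges. The six forbidden graphs are chosen so that the
   other two parts B, C may each carry a star with two edges, but only if the
   two centres are not adjacent: an edge in A and a K_4 in the union of B and C
   would span a K_6. For the lower bound, A carries the incidence graph of points
   and non-vertical lines of the affine plane over a field with 2^k elements.

   Suppose that an extremal graph is a complete join of three parts. If a part
   has fewer than 7 vertices, then, the join of a vertex with 4 K_4 being
   forbidden, the rest becomes K_4-free after the deletion of at most 16
   vertices, and Turan's theorem leaves at most n^2/3 + O(n) edges, too few. If
   all parts are larger, one of them, A, has more than 7n edges, hence contains
   claws avoiding any four given vertices. Then claw_C3 and claw_C4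
   force A to be C_3- and C_4-free, while cone_2K2, cone_claw and K6 leave at
   most two edges inside the other parts together. Replacing these edges by two
   stars with two edges each and deleting the edge between the centres gains an
   edge, a contradiction. *)

(** * Degree counts, Turán's bound and disjoint cliques *)

Section Counting.
Variables (V : finType) (G : sgraph V).
Implicit Types (S T Q : {set V}) (x y z : V).

Definition nbhd S x := [set y in S | adj G x y].

(** Adjacent pairs are ordered here, so an edge inside [S] counts twice in [arcs S S]. *)
Definition arcs S T := \sum_(x in S) #|nbhd T x|.

Lemma adj_neq x y : adj G x y -> x != y.
Proof. by apply: contraTneq => ->; rewrite adj_irrefl. Qed.

Lemma edgesP e : reflect (exists x y, adj G x y /\ e = [set x; y]) (e \in edges G).
Proof.
apply: (iffP idP) => [eG|[x [y [xy ->]]]]; last exact: xy.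
have /forall_inP/(_ _ eG)/cards2P[x [y [_ E]]] := edges_card2 G.
by exists x, y; rewrite /adj -E.
Qed.

Lemma card_nbhd S x : #|nbhd S x| = \sum_(y in S) adj G x y.
Proof. by rewrite -sum1_card -big_mkcondr; apply: eq_bigl => y; rewrite inE. Qed.

Lemma nbhd_le S x : #|nbhd S x| <= #|S|.
Proof. by apply/subset_leq_card/subsetP => y; rewrite inE => /andP[]. Qed.

Lemma arcs_sym S T : arcs S T = arcs T S.
Proof.
rewrite /arcs; under eq_bigr do rewrite card_nbhd.
rewrite exchange_big; apply: eq_bigr => y _; rewrite card_nbhd.
by apply: eq_bigr => x _; rewrite adj_sym.
Qed.

Lemma arcs_splitl S T Q : S \subset T -> arcs T Q = arcs S Q + arcs (T :\: S) Q.
Proof.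
move=> ST; rewrite /arcs (big_setID S) /=.
by congr (_ + _); apply: eq_bigl => x; rewrite (setIidPr ST).
Qed.

Lemma arcs_splitr S T Q : S \subset T -> arcs Q T = arcs Q S + arcs Q (T :\: S).
Proof. by move=> ST; rewrite 3!(arcs_sym Q) (arcs_splitl _ ST). Qed.

Lemma arcs_split S T : S \subset T ->
  arcs T T = arcs S S + 2 * arcs (T :\: S) S + arcs (T :\: S) (T :\: S).
Proof.
move=> ST; rewrite (arcs_splitl _ ST) !(arcs_splitr _ ST).
by rewrite (arcs_sym S (_ :\: _)); lia.
Qed.

Lemma arcs_le S T k : (forall x, x \in S -> #|nbhd T x| <= k) ->
  arcs S T <= #|S| * k.
Proof. by move=> H; rewrite /arcs -sum_nat_const; apply: leq_sum. Qed.

(** Each deleted vertex is the start of at most [#|V|] arcs and the end of at most [#|V|]. *)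
Lemma arcs_delete S T : S \subset T ->
  arcs T T <= 2 * #|S| * #|V| + arcs (T :\: S) (T :\: S).
Proof.
move=> ST; rewrite (arcs_split ST).
have nb T' (x : V) (_ : x \in S) := leq_trans (nbhd_le T' x) (max_card _).
have := arcs_le (nb T); rewrite (arcs_splitr _ ST) (arcs_sym S (_ :\: _)).
have := arcs_le (nb (T :\: S)); rewrite (arcs_sym S (_ :\: _)); lia.
Qed.

Lemma handshake : arcs setT setT = 2 * #|edges G|.
Proof.
have -> : 2 * #|edges G| = \sum_(e in edges G) \sum_x (x \in e).
  rewrite mulnC -sum_nat_const; apply: eq_bigr => e eG.
  have /forall_inP/(_ _ eG)/eqP <- := edges_card2 G.
  by rewrite -sum1_card big_mkcond.
rewrite exchange_big /arcs big_mkcond; apply: eq_bigr => x _ /=; rewrite in_setT.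
rewrite -big_mkcondr sum1_card.
have inj : {in nbhd setT x &, injective (fun y => [set x; y])}.
  move=> y z; rewrite !inE => /adj_neq xy /adj_neq xz E.
  have: y \in [set x; z] by rewrite -E !inE eqxx orbT.
  by rewrite !inE eq_sym (negPf xy) => /eqP.
rewrite -(card_in_imset inj); apply: eq_card => e; rewrite [RHS]inE.
apply/imsetP/andP => [[y]| [/edgesP[u [v [uv ->]]]]].
  by rewrite !inE => xy -> /=; rewrite !inE eqxx.
rewrite !inE => /orP[]/eqP ->; first by exists v; rewrite ?inE.
by exists u; rewrite 1?setUC // inE in_setT adj_sym.
Qed.

Definition clique Q := [forall x in Q, forall y in Q, (x != y) ==> adj G x y].

Lemma cliqueP Q :
  reflect {in Q &, forall x y, x != y -> adj G x y} (clique Q).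
Proof.
apply: (iffP forall_inP) => [H x y xQ yQ xy|H x xQ].
  by move/(_ _ xQ)/forall_inP/(_ _ yQ)/implyP: H; apply.
by apply/forall_inP => y yQ; apply/implyP; apply: H.
Qed.

Lemma clique_sub Q S : S \subset Q -> clique Q -> clique S.
Proof.
by move=> /subsetP SQ /cliqueP cQ; apply/cliqueP => x y /SQ ? /SQ ?; apply: cQ.
Qed.

(* Induction by removal of a clique Q of maximal size m: every other vertex has
   at most m - 1 neighbours in Q. *)
Lemma turan_bound S r :
  (forall Q, Q \subset S -> clique Q -> #|Q| <= r) ->
  r * arcs S S <= r.-1 * #|S| ^ 2.
Proof.
have [n] := ubnP #|S|; elim: n S r => // n IH S r ltSn bound.
have cl0 : (set0 \subset S) && clique set0.
  by rewrite sub0set; apply/cliqueP => x y; rewrite inE.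
pose P Q := (Q \subset S) && clique Q.
have [Q /andP[QS cQ] Qmax] := @arg_maxnP _ set0 P (fun Q => #|Q|) cl0.
have [S0 | [s sS]] := set_0Vmem S.
  by rewrite S0 /arcs big_set0 muln0.
have Q1 : 0 < #|Q|.
  rewrite -(cards1 s); apply: Qmax; rewrite /P sub1set sS.
  by apply/cliqueP => x y /set1P-> /set1P->; rewrite eqxx.
have Qr := bound _ QS cQ.
(* A vertex adjacent to all of [Q] would extend it to a larger clique. *)
have nQ x : x \in S :\: Q -> #|nbhd Q x| <= #|Q|.-1.
  rewrite inE => /andP[xQ xS]; rewrite -ltnS prednK // ltn_neqAle nbhd_le andbT.
  apply/negP => /eqP E.
  have all_adj y : y \in Q -> adj G x y.
    have /eqP <- : nbhd Q x == Q.
      by rewrite eqEcard E leqnn andbT; apply/subsetP => z; rewrite inE => /andP[].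
    by rewrite inE => /andP[].
  have: P (x |: Q).
    rewrite /P subUset sub1set xS QS; apply/cliqueP => y z.
    move=> /setU1P[->|yQ] /setU1P[->|zQ]; rewrite ?eqxx // => yz.
    - exact: all_adj.
    - by rewrite adj_sym; apply: all_adj.
    - by move/cliqueP: cQ; apply.
  by move/Qmax; rewrite cardsU1 xQ /= add1n ltnn.
have QQ : arcs Q Q <= #|Q| * #|Q|.-1.
  apply: arcs_le => x xQ; rewrite -ltnS prednK //.
  apply/proper_card/properP; split.
    by apply/subsetP => y; rewrite inE => /andP[].
  by exists x => //; rewrite inE adj_irrefl andbF.
have SQ := arcs_le nQ.
have cD : #|S| = #|Q| + #|S :\: Q| by rewrite -(cardsID Q S) (setIidPr QS).
have ltD : #|S :\: Q| < n by lia.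
have rest : #|Q| * arcs (S :\: Q) (S :\: Q) <= #|Q|.-1 * #|S :\: Q| ^ 2.
  apply: IH => // R RS cR; apply: Qmax.
  by rewrite /P cR (subset_trans RS) ?subsetDl.
(* With m = |Q| and d = |S \ Q|, the three counts add up to at most m(m - 1) + 2d(m - 1) + d^2 (m -
   1)/m, which is (m - 1)(m + d)^2 / m. *)
have main : #|Q| * arcs S S <= #|Q|.-1 * #|S| ^ 2.
  rewrite (arcs_split QS) cD.
  move: (#|Q|) (#|S :\: Q|) (arcs _ _) (arcs _ _) (arcs _ _) Q1 QQ SQ rest.
  case=> // m d a b e _ /=; nia.
(* It remains to replace |Q| by the possibly larger [r]: the ratio (m - 1)/m increases with m. *)
move: main Qr Q1; clear; move: (#|Q|) (arcs _ _) (#|S| ^ 2) => m a s.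
case: m => // m /= H mr _; case: r mr => // r /= mr.
rewrite -(leq_pmul2l (ltn0Sn m)) mulnCA.
apply: leq_trans (_ : r.+1 * (m * s) <= _); first by rewrite leq_mul2l H orbT.
rewrite !mulnA leq_mul2r; apply/orP; right; lia.
Qed.

(** Greedy choice: as long as a K_4 avoids those already chosen, it is added to them. If the choice
    stops early, the union [U] of the chosen ones meets every K_4 in [S]. *)
Lemma disjoint_cliques k S :
  (exists f : nat -> {set V},
     [/\ forall i, i < k -> f i \subset S,
         forall i, i < k -> clique (f i) /\ #|f i| = 4 &
         forall i j, i < k -> j < k -> i != j -> [disjoint f i & f j]]) \/
  (exists U : {set V}, [/\ U \subset S, #|U| <= 4 * k &
     forall Q, Q \subset S :\: U -> clique Q -> #|Q| <= 3]).
Proof.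
elim: k => [|k [[f [fS fc fd]]|[U [US cU UQ]]]].
- by left; exists (fun=> set0); split.
- pose U := \bigcup_(i < k) f i.
  have cU : #|U| <= 4 * k.
    apply: leq_trans (_ : \sum_(i < k) 4 <= _); last first.
      by rewrite sum_nat_const card_ord mulnC.
    apply: (big_ind2 (fun (A : {set V}) m => #|A| <= m)); first by rewrite cards0.
      move=> A a B b leA leB.
      exact: leq_trans (leq_card_setU A B).1 (leq_add leA leB).
    by move=> i _; case: (fc i (ltn_ord i)) => _ ->.
  have US : U \subset S by apply/bigcupsP => i _; apply: fS.
  have [/existsP[Q /and3P[QS cQ Q4]]|no] :=
    boolP [exists Q : {set V}, [&& Q \subset S :\: U, clique Q & 3 < #|Q|]].
  + have [s [Us s4 sQ]] := card_geqP Q4; pose R := [set x in s].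
    have RQ : R \subset Q by apply/subsetP => x; rewrite inE; apply: sQ.
    have R4 : #|R| = 4 by rewrite cardsE (card_uniqP Us).
    left; exists (fun i => if i == k then R else f i).
    have RSU := subset_trans RQ QS.
    have dR i : i < k -> [disjoint R & f i].
      move=> ik; apply: disjointWl RSU _; apply/pred0P => x /=; rewrite !inE.
      apply/negP => /andP[/andP[/negP xU _] xf]; apply: xU.
      by apply/bigcupP; exists (Ordinal ik).
    split=> [i|i|i j].
    * rewrite ltnS leq_eqVlt; case: eqP => [_ _|_ /= ik]; last exact: fS.
      by apply: subset_trans RSU _; rewrite subsetDl.
    * rewrite ltnS leq_eqVlt; case: eqP => [_ _|_ /= ik]; last exact: fc.
      by split=> //; apply: clique_sub cQ.
    rewrite !ltnS (leq_eqVlt i) (leq_eqVlt j).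
    case: (i =P k) => [->|_] /=; case: (j =P k) => [->|_] /= ik jk //.
    * by rewrite eqxx.
    * by move=> _; apply: dR.
    * by move=> _; rewrite disjoint_sym; apply: dR.
    * exact: fd.
  right; exists U; split=> //; first by rewrite (leq_trans cU) // leq_mul2l leqnSn.
  move=> Q QS cQ; rewrite leqNgt; apply: contra no => Q4.
  by apply/existsP; exists Q; rewrite QS cQ.
by right; exists U; split=> //; rewrite (leq_trans cU) // leq_mul2l leqnSn.
Qed.

End Counting.

(** * The forbidden graphs *)

Definition edge_in (e : seq (nat * nat)) (i j : nat) :=
  ((i, j) \in e) || ((j, i) \in e).

(** The boolean names the side of K_{7,7}. Seven vertices distributed over three parts put three
    into the same part, which is what [card_pigeon] extracts from a side. *)
Definition gadget_vertex q := ('I_q + bool * 'I_7)%type.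

Definition gadget_rel q e (u v : gadget_vertex q) : bool :=
  match u, v with
  | inl i, inl j => edge_in e i j
  | inr s, inr t => s.1 != t.1
  | _, _ => true
  end.

(* The join of the graph on {0, ..., q - 1} with edge list e and K_{7,7}. *)
Definition gadget q e : graph := Graph (graph_of (@gadget_rel q e)).

Definition K6 : graph := Graph (graph_of (fun _ _ : 'I_6 => true)).

(** [None] is the apex, and the first index of a pair names the copy of K_4. There are four copies
    because in a template three vertices suffice to meet every K_4 in the neighbourhood of a given
    vertex. *)
Definition apex_rel (u v : option ('I_4 * 'I_4)) : bool :=
  match u, v with Some a, Some b => a.1 == b.1 | _, _ => true end.

Definition apex_4K4 : graph := Graph (graph_of apex_rel).

Definition claw_C3 := gadget 7 [:: (0, 1); (1, 2); (0, 2); (3, 4); (3, 5); (3, 6)].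
Definition claw_C4 :=
  gadget 8 [:: (0, 1); (1, 2); (2, 3); (0, 3); (4, 5); (4, 6); (4, 7)].
Definition cone_2K2 :=
  gadget 5 [:: (0, 1); (0, 2); (0, 3); (0, 4); (1, 2); (3, 4)].
Definition cone_claw :=
  gadget 5 [:: (0, 1); (0, 2); (0, 3); (0, 4); (1, 2); (1, 3); (1, 4)].

Definition forbidden : seq graph :=
  [:: apex_4K4; K6; claw_C3; claw_C4; cone_2K2; cone_claw].

Lemma gadget_rel_sym q e : symmetric (@gadget_rel q e).
Proof.
case=> [i|s] [j|t] //=; first by rewrite /edge_in orbC.
by rewrite eq_sym.
Qed.

Lemma apex_rel_sym : symmetric apex_rel.
Proof. by case=> [a|] [b|] //=; rewrite eq_sym. Qed.

(** * Criteria for containing a forbidden graph *)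

Section Contains.
Variables (V : finType) (G : sgraph V).

Lemma containsP (W : finType) (F : sgraph W) :
  reflect (exists f : W -> V, injective f /\
             forall x y, adj F x y -> adj G (f x) (f y))
          (contains G F).
Proof.
apply: (iffP existsP) => [[f /andP[/injectiveP If /forallP H]]|[f [If H]]].
  exists f; split=> // x y; exact: implyP (forallP (H x) y).
exists (finfun f); apply/andP; split.
  by apply/injectiveP => x y; rewrite !ffunE; apply: If.
by apply/'forall_forallP => x y; rewrite !ffunE; apply/implyP/H.
Qed.

(** The core is given as a list, to match the numbering of [e], and the sides as sets. No
    disjointness is asked: vertices of different groups are adjacent, hence distinct. The condition
    on [e] keeps the indices in range and excludes loops. *)
Lemma contains_gadgetP q e : all (fun p => p.1 < p.2 < q) e ->
  contains G (sgraph_of (gadget q e)) <->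
  exists (s : seq V) (S : bool -> {set V}),
    [/\ uniq s, size s = q,
        forall x0, all (fun p => adj G (nth x0 s p.1) (nth x0 s p.2)) e,
        forall b, 7 <= #|S b| &
        (forall x b y, x \in s -> y \in S b -> adj G x y) /\
        (forall x y, x \in S true -> y \in S false -> adj G x y)].
Proof.
move=> eq; split.
  case/containsP => f [If H].
  have {H} H x y : x != y -> gadget_rel e x y -> adj G (f x) (f y).
    by move=> xy exy; apply: H; rewrite adj_graph_of ?xy //; apply: gadget_rel_sym.
  exists [seq f (inl i) | i <- enum 'I_q].
  exists (fun b => [set f (inr (b, k)) | k : 'I_7]); split.
  - by rewrite map_inj_uniq ?enum_uniq // => i j /If[].
  - by rewrite size_map size_enum_ord.
  - move=> x0; apply/allP => p pe; have /andP[p12 p2] := allP eq p pe.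
    have p1 := ltn_trans p12 p2.
    have E m (mq : m < q) :
        nth x0 [seq f (inl i) | i <- enum 'I_q] m = f (inl (Ordinal mq)).
      rewrite (nth_map (Ordinal mq)); last by rewrite size_enum_ord.
      by congr (f (inl _)); apply: (nth_ord_enum _ (Ordinal mq)).
    rewrite (E _ p1) (E _ p2); apply: H.
      by apply/eqP => -[] E12; rewrite E12 ltnn in p12.
    by rewrite /= /edge_in -surjective_pairing pe.
  - by move=> b; rewrite card_imset ?card_ord // => i j /If[].
  - by split=> [x b y /mapP[i _ ->] /imsetP[k _ ->]|
                x y /imsetP[i _ ->] /imsetP[k _ ->]]; apply: H.
move=> [s [S [Us sq Hs S7 [sS SS]]]].
have /card_gt0P[x0 _] := leq_trans (isT : 0 < 7) (S7 true).
have nthS b (k : 'I_7) : nth x0 (enum (S b)) k \in S b.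
  by rewrite -mem_enum mem_nth // -cardE (leq_trans (ltn_ord k)).
have nths (i : 'I_q) : nth x0 s i \in s by rewrite mem_nth // sq.
pose f (u : gadget_vertex q) := match u with
  | inl i => nth x0 s i | inr a => nth x0 (enum (S a.1)) a.2 end.
have sS' i a : adj G (f (inl i)) (f (inr a)) by apply: sS; [apply: nths|apply: nthS].
have SS' a b : a.1 != b.1 -> adj G (f (inr a)) (f (inr b)).
  move: a b => [[] a] [[] b] //= _; first by apply: SS; apply: nthS.
  by rewrite adj_sym; apply: SS; apply: nthS.
apply/containsP; exists f; split.
  move=> [i|a] [j|b].
  - move=> /eqP; rewrite nth_uniq ?sq // => /eqP ij.
    by congr inl; apply: val_inj.
  - by move=> E; have := adj_neq (sS' i b); rewrite E eqxx.
  - by move=> E; have := adj_neq (sS' j a); rewrite E eqxx.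
  - move=> E; have [ab|ab] := eqVneq a.1 b.1; last first.
      by have := adj_neq (SS' _ _ ab); rewrite E eqxx.
    move: a b ab E => [a k] [b l] /= <- /eqP.
    rewrite nth_uniq ?enum_uniq -?cardE ?(leq_trans (ltn_ord _)) //.
    by move=> /eqP kl; congr (inr (_, _)); apply: val_inj.
move=> u v; rewrite adj_graph_of; last exact: gadget_rel_sym.
move=> /andP[_]; case: u v => [i|a] [j|b] //=; last 3 first.
- by move=> _; apply: sS'.
- by move=> _; rewrite adj_sym; apply: sS'.
- exact: SS'.
rewrite /edge_in => /orP[] /(allP (Hs x0)) //=.
by rewrite adj_sym.
Qed.

Lemma contains_K6P : contains G (sgraph_of K6) <->
  exists s : seq V, [/\ uniq s, size s = 6 &
    {in s &, forall x y, x != y -> adj G x y}].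
Proof.
split=> [/containsP[f [If H]]|[s [Us s6 H]]].
  exists [seq f i | i <- enum 'I_6]; split.
  - by rewrite map_inj_uniq ?enum_uniq.
  - by rewrite size_map size_enum_ord.
  - move=> _ _ /mapP[i _ ->] /mapP[j _ ->] fij; apply: H.
    by rewrite adj_graph_of // andbT; apply: contraNneq fij => ->.
case: s Us s6 H => // x0 s Us s6 H.
apply/containsP; exists (fun i : 'I_6 => nth x0 (x0 :: s) i).
have inj i j : i < 6 -> j < 6 -> (nth x0 (x0 :: s) i == nth x0 (x0 :: s) j) = (i == j).
  by move=> *; rewrite nth_uniq // s6.
split=> [i j /eqP|i j]; first by rewrite inj // => /eqP/val_inj.
rewrite adj_graph_of // andbT => ij; apply: H.
- by apply: mem_nth; rewrite s6.
- by apply: mem_nth; rewrite s6.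
- by rewrite inj.
Qed.

Lemma contains_apex v (f : nat -> {set V}) :
  (forall i, i < 4 -> [/\ f i \subset nbhd G setT v, clique G (f i) & #|f i| = 4]) ->
  (forall i j, i < 4 -> j < 4 -> i != j -> [disjoint f i & f j]) ->
  contains G (sgraph_of apex_4K4).
Proof.
move=> H dis; pose g (a : 'I_4 * 'I_4) := nth v (enum (f a.1)) a.2.
have gf a : g a \in f a.1.
  have [_ _ f4] := H _ (ltn_ord a.1).
  by rewrite -mem_enum mem_nth // -cardE f4.
have vg a : adj G v (g a).
  have [/subsetP/(_ _ (gf a)) + _ _] := H _ (ltn_ord a.1).
  by rewrite inE => /andP[].
have Ig : injective g.
  move=> [i k] [j l] E; have [ij|ij] := eqVneq i j; last first.
    have /pred0P/(_ (g (i, k))) := dis _ _ (ltn_ord i) (ltn_ord j) ij.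
    by rewrite /= (gf (i, k)) /= E (gf (j, l)).
  move: E; rewrite ij => /eqP; have [_ _ f4] := H _ (ltn_ord j).
  by rewrite nth_uniq ?enum_uniq -?cardE ?f4 //= => /eqP/val_inj ->.
apply/containsP; exists (fun u => if u is Some a then g a else v); split.
  move=> [a|] [b|] //; first by move=> /Ig ->.
    by move=> E; have := adj_neq (vg a); rewrite E eqxx.
  by move=> E; have := adj_neq (vg b); rewrite -E eqxx.
move=> u w; rewrite adj_graph_of; last exact: apex_rel_sym.
case: u w => [a|] [b|] //=; last first.
- by move=> _; rewrite adj_sym.
- move=> /andP[ab /eqP E]; have [_ /cliqueP cl _] := H _ (ltn_ord a.1).
  apply: cl; rewrite ?gf // ?E ?gf //.
  by rewrite (inj_eq Ig); apply: contraNneq ab => ->.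
Qed.

End Contains.

(** * Chromatic numbers of the forbidden graphs *)

Lemma chromatic_ge (W : finType) (F : sgraph W) (s : seq W) :
  uniq s -> {in s &, forall x y, x != y -> adj F x y} ->
  size s <= chromatic_number F.
Proof.
move=> Us H; rewrite /chromatic_number; case: ex_minnP => k /existsP[c /forallP ck] _.
have inj : {in s &, injective c}.
  move=> x y xs ys E; apply/eqP; apply: contraTT isT => xy.
  by have /forallP/(_ y) := ck x; rewrite (H x y) //= E eqxx.
have /card_uniqP Ec : uniq [seq c x | x <- s] by rewrite map_inj_in_uniq.
by have := max_card [in [seq c x | x <- s]]; rewrite card_ord Ec size_map.
Qed.

Lemma chromatic_le (W : finType) (F : sgraph W) k (c : W -> 'I_k) :
  (forall x y, adj F x y -> c x != c y) -> chromatic_number F <= k.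
Proof.
move=> H; rewrite /chromatic_number; case: ex_minnP => m _; apply.
apply/existsP; exists (finfun c); apply/'forall_forallP => x y.
by rewrite !ffunE; apply/implyP/H.
Qed.

Lemma min_seq_le s m : {in s, forall k, m <= k} -> m \in s -> min_seq s = m.
Proof.
move=> H ms; apply/eqP; rewrite eqn_leq /min_seq; apply/andP; split.
  elim: s (head 0 s) ms {H} => // a s IH d; rewrite inE big_cons geq_min.
  by case/predU1P => [->|/(IH d) ->]; rewrite ?leqnn ?orbT.
rewrite big_seq; apply: (big_ind (fun k => m <= k)) => //.
  by case: s ms H => // a s _ H; apply: H; rewrite mem_head.
by move=> a b am bm; rewrite leq_min am.
Qed.

(** A core edge and one vertex from each side of K_{7,7} form a K_4. *)
Lemma gadget_chromatic_ge q e i j : (i, j) \in e -> i < j < q ->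
  4 <= chromatic_number (sgraph_of (gadget q e)).
Proof.
move=> ije /andP[ij jq]; have iq := ltn_trans ij jq.
pose s : seq (gadget_vertex q) :=
  [:: inl (Ordinal iq); inl (Ordinal jq); inr (true, ord0); inr (false, ord0)].
have ne : Ordinal iq != Ordinal jq by rewrite -(inj_eq val_inj) /= neq_ltn ij.
apply: (@chromatic_ge _ _ s); first by rewrite /= !inE (inj_eq inl_inj) (negPf ne).
move=> x y xs ys xy; rewrite adj_graph_of ?xy /=; last exact: gadget_rel_sym.
move: xs ys xy; rewrite !inE.
by move=> /or4P[]/eqP-> /or4P[]/eqP->; rewrite ?eqxx //= /edge_in ije ?orbT.
Qed.

(** All six graphs contain a K_4, and [claw_C4] attains the minimum 4 because its core is
    bipartite. *)
Lemma p_forbidden : p_family forbidden = 3.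
Proof.
rewrite /p_family (@min_seq_le _ 4) //.
  apply/allP; rewrite all_map; apply/andP; split.
    pose s : seq (option ('I_4 * 'I_4)) := [seq Some (ord0, k) | k <- enum 'I_4].
    apply: leq_trans (_ : size s <= _); first by rewrite size_map size_enum_ord.
    apply: chromatic_ge.
      by rewrite map_inj_uniq ?enum_uniq // => i j [].
    move=> _ _ /mapP[i _ ->] /mapP[j _ ->] ij.
    by rewrite adj_graph_of ?ij //; apply: apex_rel_sym.
  apply/andP; split.
    apply: leq_trans (_ : size (enum 'I_6) <= _); first by rewrite size_enum_ord.
    by apply: chromatic_ge; rewrite ?enum_uniq // => i j _ _ ij; rewrite adj_graph_of ?ij.
  by do 4 (apply/andP; split; first exact: (@gadget_chromatic_ge _ _ 0 1)).
have le4 : chromatic_number (sgraph_of claw_C4) <= 4.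
  (* Colours 0 and 1 serve the core: the class of 1 consists of two opposite vertices of the cycle
     and the centre of the claw. The two sides get the colours 2 and 3. *)
  pose c (u : gadget_vertex 8) : nat := match u with
    | inl i => (val i \in [:: 1; 3; 4]) | inr a => 2 + a.1 end.
  have c4 u : c u < 4 by case: u => [i|[[] k]] //=; case: (_ \in _).
  apply: (@chromatic_le _ _ _ (fun u => Ordinal (c4 u))) => x y.
  rewrite adj_graph_of; last exact: gadget_rel_sym.
  rewrite -(inj_eq val_inj) /=; case: x y => [x|[[] k]] [y|[[] l]] /andP[_] //=.
  - rewrite /edge_in !inE -!pair_eqE /=.
    by case: x y => [[|[|[|[|[|[|[|[|x]]]]]]]] Hx] // [[|[|[|[|[|[|[|[|y]]]]]]]] Hy].
  - by case: (_ \in _).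
  - by case: (_ \in _).
  - by case: (_ \in _).
  - by case: (_ \in _).
have /eqP <- : chromatic_number (sgraph_of claw_C4) == 4.
  by rewrite eqn_leq le4 (@gadget_chromatic_ge _ _ 0 1).
by rewrite /= !inE eqxx !orbT.
Qed.

(** * Graphs that fit the template are free *)

(* None is the part A, and Some true, Some false are the parts B, C; hub b is the
   centre of the star in the part Some b. *)
Record template (V : finType) (G : sgraph V) (col : V -> option bool)
    (hub : bool -> V) : Prop := Template {
  tm_C3 : forall x y z, col x = None -> col y = None -> col z = None ->
    adj G x y -> adj G y z -> adj G x z -> False;
  tm_C4 : forall x x' y y', col x = None -> col x' = None ->
    col y = None -> col y' = None -> x != x' -> y != y' ->
    adj G x y -> adj G x y' -> adj G x' y -> adj G x' y' -> False;
  tm_hub : forall b x y, col x = Some b -> col y = Some b -> adj G x y ->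
    x = hub b \/ y = hub b;
  tm_deg : forall b x, col x = Some b ->
    #|nbhd G [set y | col y == Some b] x| <= 2;
  tm_hubs : ~~ adj G (hub true) (hub false) }.

Section Template.
Variables (V : finType) (G : sgraph V) (col : V -> option bool) (hub : bool -> V).
Hypothesis tm : template G col hub.

Definition colored (Q : {set V}) (c : option bool) := [set x in Q | col x == c].

Lemma hubs_nadj b : adj G (hub b) (hub (~~ b)) = false.
Proof.
by apply/negbTE; have := tm_hubs tm; case: b => //; rewrite adj_sym.
Qed.

Lemma card_colors (S : {set V}) :
  #|S| = \sum_(c : option bool) #|colored S c|.
Proof.
rewrite -sum1_card (partition_big col xpredT) //; apply: eq_bigr => c _.
by rewrite -sum1_card; apply: eq_bigl => x; rewrite !inE.
Qed.

Lemma sum_colors (F : option bool -> nat) :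
  \sum_c F c = F None + F (Some true) + F (Some false).
Proof.
rewrite (bigD1 None) // (bigD1 (Some true)) // (bigD1 (Some false)) //= big1.
  by rewrite addn0 addnA.
by move=> [[]|].
Qed.

Lemma few_None v Q : clique G Q -> Q \subset nbhd G setT v -> col v = None ->
  #|colored Q None| <= 1.
Proof.
move=> /cliqueP cQ /subsetP Qv vN; rewrite leqNgt; apply/negP => /card_gt1P.
move=> [x [y []]]; rewrite !inE => /andP[xQ /eqP xN] /andP[yQ /eqP yN] xy.
have := Qv x xQ; have := Qv y yQ; rewrite !inE /= => vy vx.
exact: (tm_C3 tm vN xN yN vx (cQ x y xQ yQ xy) vy).
Qed.

Lemma None_le2 Q : clique G Q -> #|colored Q None| <= 2.
Proof.
move=> /cliqueP cQ; rewrite leqNgt; apply/negP => /card_gt2P.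
move=> [x [y [z [[]]]]]; rewrite !inE => /andP[xQ /eqP xN] /andP[yQ /eqP yN].
move=> /andP[zQ /eqP zN] [xy yz zx].
apply: (tm_C3 tm xN yN zN (cQ _ _ xQ yQ xy) (cQ _ _ yQ zQ yz)).
by apply: cQ; rewrite // eq_sym.
Qed.

Lemma Some_le1 b Q : clique G Q -> hub b \notin Q ->
  #|colored Q (Some b)| <= 1.
Proof.
move=> /cliqueP cQ hQ; rewrite leqNgt; apply/negP => /card_gt1P.
move=> [x [y []]]; rewrite !inE => /andP[xQ /eqP xb] /andP[yQ /eqP yb] xy.
by case: (tm_hub tm xb yb (cQ _ _ xQ yQ xy)) => E; rewrite -E ?xQ ?yQ in hQ.
Qed.

Lemma Some_le2 b Q : clique G Q -> #|colored Q (Some b)| <= 2.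
Proof.
move=> cQ; have := @Some_le1 b (Q :\ hub b) (clique_sub (subD1set _ _) cQ).
rewrite !inE eqxx => /(_ isT) le1.
apply: leq_trans (_ : #|hub b |: colored (Q :\ hub b) (Some b)| <= _).
  by apply/subset_leq_card/subsetP => x; rewrite !inE; case: (x =P hub b).
by rewrite cardsU1 !inE eqxx.
Qed.

(** A template does not prescribe the colour of [hub b]; an edge inside the part [Some b] forces
    it. *)
Lemma Some_hub b Q : clique G Q -> 2 <= #|colored Q (Some b)| ->
  hub b \in Q /\ col (hub b) = Some b.
Proof.
move=> /cliqueP cQ /card_gt1P[x [y []]]; rewrite !inE.
move=> /andP[xQ /eqP xb] /andP[yQ /eqP yb] xy.
by case: (tm_hub tm xb yb (cQ _ _ xQ yQ xy)) => <-.
Qed.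

(** A clique has at most two vertices in each part. A K_6 would have exactly two in each, hence
    contain both centres, which are not adjacent. *)
Lemma template_K6 : ~~ contains G (sgraph_of K6).
Proof.
apply/negP => /contains_K6P[s [Us s6 cs]].
have cQ : clique G [set x in s].
  by apply/cliqueP => x y; rewrite !inE; apply: cs.
have := card_colors [set x in s]; rewrite cardsE (card_uniqP Us) s6 sum_colors.
have := None_le2 cQ; have := @Some_le2 true _ cQ; have := @Some_le2 false _ cQ.
move=> f2 t2 n2 E6.
have [ht ct] : hub true \in [set x in s] /\ col (hub true) = Some true.
  by apply: Some_hub => //; lia.
have [hf cf] : hub false \in [set x in s] /\ col (hub false) = Some false.
  by apply: Some_hub => //; lia.
have ne : hub true != hub false by apply: contra_eq_neq ct => ->; rewrite cf.
by have /cliqueP/(_ _ _ ht hf ne) := cQ; rewrite (hubs_nadj true).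
Qed.

Lemma template_apex : ~~ contains G (sgraph_of apex_4K4).
Proof.
apply/negP => /containsP[f [If H]].
have {H} H x y : x != y -> apex_rel x y -> adj G (f x) (f y).
  by move=> xy exy; apply: H; rewrite adj_graph_of ?xy //; apply: apex_rel_sym.
pose v := f None; pose K i := [set f (Some (i, k)) | k : 'I_4].
have K4 i : #|K i| = 4 by rewrite card_imset ?card_ord // => k l /If[].
have cK i : clique G (K i).
  apply/cliqueP => _ _ /imsetP[k _ ->] /imsetP[l _ ->] kl.
  by apply: H => /=; [apply: contraNneq kl => ->|].
have vK i : K i \subset nbhd G setT v.
  by apply/subsetP => _ /imsetP[k _ ->]; rewrite !inE; apply: H.
(* Three vertices cannot meet four disjoint cliques. *)
have avoid (U : {set V}) : #|U| <= 3 -> exists i, [disjoint K i & U].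
  move=> U3; apply/existsP; apply: contraTT U3 => /existsPn meet; rewrite -ltnNge.
  have {meet} meet i : exists k, f (Some (i, k)) \in U.
    have /pred0Pn[x /andP[/imsetP[k _ ->] fU]] := meet i.
    by exists k.
  have [g gU] : exists g : 'I_4 -> 'I_4, forall i, f (Some (i, g i)) \in U.
    by exists (fun i => xchoose (meet i)) => i; exact: xchooseP (meet i).
  have <- : #|[set f (Some (i, g i)) | i : 'I_4]| = 4.
    by rewrite card_imset ?card_ord // => i j /If[].
  by apply/subset_leq_card/subsetP => _ /imsetP[i _ ->].
have [vN|[b vb]] : col v = None \/ exists b, col v = Some b.
- by case: (col v) => [b|]; [right; exists b|left].
(* The apex is in A: a clique of its neighbourhood that avoids both centres has at most one vertex
   in each part. *)
- have [|i dis] := avoid [set hub true; hub false].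
    by rewrite cards2; case: (_ != _).
  have hK b : hub b \notin K i.
    apply/negP => hK; have /pred0P/(_ (hub b)) := dis.
    by rewrite /= hK !inE; case: b {hK}; rewrite eqxx ?orbT.
  have := card_colors (K i); rewrite K4 sum_colors.
  have := few_None (cK i) (vK i) vN.
  by have := Some_le1 (cK i) (hK true); have := Some_le1 (cK i) (hK false); lia.
(* The apex is in the part [Some b]: a K_4 that avoids its at most two neighbours there and the
   other centre has no vertex in this part, at most one in the other starred part and at most two in
   A. *)
pose U := hub (~~ b) |: nbhd G [set y | col y == Some b] v.
have [|i dis] := avoid U.
  by rewrite cardsU1; have := tm_deg tm vb; case: (_ \notin _) => /=; lia.
have KU x : x \in K i -> x \notin U.
  by move=> xK; apply/negP => xU; have /pred0P/(_ x) := dis; rewrite /= xK xU.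
have := card_colors (K i); rewrite K4 sum_colors.
have := None_le2 (cK i).
have hK : hub (~~ b) \notin K i.
  by apply: contraTN isT => /KU; rewrite !inE eqxx.
have := Some_le1 (cK i) hK.
have : #|colored (K i) (Some b)| = 0.
  apply: eq_card0 => x; rewrite !inE; apply/negP => /andP[xK xb].
  have := KU x xK; rewrite !inE xb /= negb_or => /andP[_].
  by have /subsetP/(_ x xK) := vK i; rewrite !inE /= => ->.
by case: b {vb hK U KU dis} => /=; lia.
Qed.

Lemma card_pigeon (S : {set V}) : 7 <= #|S| ->
  exists c, 3 <= #|colored S c|.
Proof.
rewrite card_colors sum_colors => S7.
have [|] := leqP 3 #|colored S None|; first by exists None.
have [|] := leqP 3 #|colored S (Some true)|; first by exists (Some true).
have [|] := leqP 3 #|colored S (Some false)|; first by exists (Some false).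
lia.
Qed.

Lemma nadj3 b x (S : {set V}) : 3 <= #|S| -> {in S, forall y, col y = Some b} ->
  {in S, forall y, adj G x y} -> col x != Some b.
Proof.
move=> S3 Sb Sx; apply/eqP => xb; have := tm_deg tm xb; rewrite leqNgt.
move/negP; apply; apply: leq_trans S3 _; apply/subset_leq_card/subsetP => y yS.
by rewrite !inE Sb // eqxx Sx.
Qed.

(** Two vertices of A with two common neighbours in A would close a C_4. *)
Lemma nadj2 x x' (S : {set V}) : 2 <= #|S| -> {in S, forall y, col y = None} ->
  {in S, forall y, adj G x y /\ adj G x' y} -> col x = None -> col x' = None -> x = x'.
Proof.
move=> /card_gt1P[y [y' [yS y'S yy']]] SN Sx xN x'N; apply/eqP/negPn/negP => xx'.
have [xy x'y] := Sx y yS; have [xy' x'y'] := Sx y' y'S.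
exact: (tm_C4 tm xN x'N (SN _ yS) (SN _ y'S) xx' yy').
Qed.

(** Each side of the K_{7,7} has three vertices in a single part. The parts so obtained from the two
    sides differ. If they are B and C, every common neighbour lies in A, since degrees inside B and
    C are at most 2. If one of them is A, the common neighbours lie in A or in the third part, with
    at most one in A. *)
Lemma K77_neighbours (S : bool -> {set V}) (s : seq V) :
  (forall b, 7 <= #|S b|) -> (forall x b y, x \in s -> y \in S b -> adj G x y) ->
  (forall x y, x \in S true -> y \in S false -> adj G x y) ->
  {in s, forall x, col x = None} \/
  exists b, {in s, forall x, col x != None -> col x = Some b} /\
            {in s &, forall x y, col x = None -> col y = None -> x = y}.
Proof.
move=> S7 sS SS.
have [c1 le1] := card_pigeon (S7 true); have [c2 le2] := card_pigeon (S7 false).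
set S1 := colored _ _ in le1; set S2 := colored _ _ in le2.
have c1S : {in S1, forall y, col y = c1} by move=> y; rewrite inE => /andP[_ /eqP].
have c2S : {in S2, forall y, col y = c2} by move=> y; rewrite inE => /andP[_ /eqP].
have S1S : {subset S1 <= S true} by move=> y; rewrite inE => /andP[].
have S2S : {subset S2 <= S false} by move=> y; rewrite inE => /andP[].
have sS1 x y : x \in s -> y \in S1 -> adj G x y by move=> xs /S1S; apply: sS.
have sS2 x y : x \in s -> y \in S2 -> adj G x y by move=> xs /S2S; apply: sS.
have S12 x y : x \in S1 -> y \in S2 -> adj G x y by move=> /S1S + /S2S; apply: SS.
clearbody S1 S2.
(* No part contains a K_{3,3}: A has no C_4, and degrees inside the other parts are at most 2. *)
have c12 : c1 != c2.
  apply/eqP => E; subst c2; have /card_gt0P[x xS] := ltnW (ltnW le1).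
  have [b|] := altP (c1 =P None).
    subst c1.
    have [x1 [x2 [x1S x2S x12]]] := card_gt1P (ltnW le1).
    move/eqP: x12; apply; apply: (nadj2 (ltnW le2) c2S) => [y yS||]; rewrite ?c1S //.
    by split; apply: S12.
  case: c1 c1S c2S => // b c1S c2S _.
  have /eqP[] := nadj3 le2 c2S (fun y yS => S12 x y xS yS); exact: c1S.
have oneN (S' : {set V}) : 3 <= #|S'| -> {in S', forall y, col y = None} ->
    (forall x y, x \in s -> y \in S' -> adj G x y) ->
    {in s &, forall x y, col x = None -> col y = None -> x = y}.
  move=> S'3 S'N sS' x y xs ys; apply: (nadj2 (ltnW S'3) S'N) => z zS.
  by split; apply: sS'.
have noS b (S' : {set V}) : 3 <= #|S'| -> {in S', forall y, col y = Some b} ->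
    (forall x y, x \in s -> y \in S' -> adj G x y) ->
    {in s, forall x, col x != None -> col x = Some (~~ b)}.
  move=> S'3 S'b sS' x xs; have := nadj3 S'3 S'b (fun y yS => sS' x y xs yS).
  by case: (col x) => // -[]; case: (b).
case: c1 c2 c12 c1S c2S => [b1|] [b2|] c12 c1S c2S //.
- left=> x xs; apply/eqP; apply: contraTT isT => xN.
  have := noS _ _ le1 c1S sS1 x xs xN; rewrite (noS _ _ le2 c2S sS2 x xs xN).
  by move: c12; case: b1 b2 {c1S c2S} => [] [].
- right; exists (~~ b1); split; first exact: noS le1 c1S sS1.
  exact: oneN le2 c2S sS2.
right; exists (~~ b2); split; first exact: noS le2 c2S sS2.
exact: oneN le1 c1S sS1.
Qed.

Lemma no_claw b x (s : seq V) : uniq s -> size s = 3 -> col x = Some b ->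
  {in s, forall y, col y = Some b} -> {in s, forall y, adj G x y} -> False.
Proof.
move=> Us s3 xb sb sx; suff: col x != Some b by rewrite xb eqxx.
apply: (@nadj3 b x [set y in s]).
- by rewrite cardsE (card_uniqP Us) s3.
- by move=> y; rewrite inE; apply: sb.
- by move=> y; rewrite inE; apply: sx.
Qed.

Lemma no_2K2 b x y z t : col x = Some b -> col y = Some b -> col z = Some b ->
  col t = Some b -> uniq [:: x; y; z; t] -> adj G x y -> adj G z t -> False.
Proof.
move=> xb yb zb tb + xy zt; rewrite /= !inE => U.
case: (tm_hub tm xb yb xy) => E1; case: (tm_hub tm zb tb zt) => E2;
  by move: U; rewrite E1 E2 eqxx ?orbT ?andbF.
Qed.

Lemma no_K3 b x y z : col x = Some b -> col y = Some b -> col z = Some b ->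
  adj G x y -> adj G y z -> adj G x z -> False.
Proof.
move=> xb yb zb xy yz xz.
have := adj_neq xy; have := adj_neq yz; have := adj_neq xz.
case: (tm_hub tm xb yb xy) => E1; case: (tm_hub tm xb zb xz) => E2;
case: (tm_hub tm yb zb yz) => E3; by rewrite ?E1 ?E2 ?E3 ?eqxx // -?E1 -?E2 ?eqxx.
Qed.

(** By [K77_neighbours] the core lies either in A or, except for at most one vertex in A, in a
    single other part. *)
Lemma no_gadget q e : all (fun p => p.1 < p.2 < q) e ->
  (forall s : seq V, uniq s -> size s = q ->
     (forall x0, all (fun p => adj G (nth x0 s p.1) (nth x0 s p.2)) e) ->
     ~ {in s, forall x, col x = None} /\
     forall b, {in s, forall x, col x != None -> col x = Some b} ->
       {in s &, forall x y, col x = None -> col y = None -> x = y} -> False) ->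
  ~~ contains G (sgraph_of (gadget q e)).
Proof.
move=> eq H; apply/negP => /(contains_gadgetP _ eq)[s [S [Us sq es S7 [sS SS]]]].
have [HN HS] := H s Us sq es.
by case: (K77_neighbours S7 sS SS) => [//|[b []]]; apply: HS.
Qed.

Lemma template_claw_C3 : ~~ contains G (sgraph_of claw_C3).
Proof.
apply: no_gadget => // -[|x0 [|x1 [|x2 [|x3 [|x4 [|x5 [|x6 [|]]]]]]]] // Us _ /(_ x0).
move=> /= /and5P[a01 a12 a02 a34 /and3P[a35 a36 _]].
set s := [:: x0; _; _; _; _; _; _] in Us *.
have xs : {subset s <= s} by [].
split=> [N|b B one].
  by apply: (tm_C3 tm _ _ _ a01 a12 a02); apply: N; rewrite !inE eqxx ?orbT.
(* At most one core vertex lies in A. If it is not in the claw, the claw lies in the part [Some b],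
   where degrees are at most 2; if it is, the whole triangle lies in that part, whose edges form a
   star. *)
have [/allP cl|/allPn[y yc /negPn/eqP yN]] := boolP (all (fun x => col x != None) [:: x3; x4; x5; x6]).
  have clb y : y \in [:: x3; x4; x5; x6] -> col y = Some b.
    by move=> yc; apply: B; [move: yc; rewrite !inE => ->; rewrite ?orbT|apply: cl].
  apply: (@no_claw b x3 [:: x4; x5; x6]) => //.
  - by move: Us; rewrite /s -[_ :: _ :: _ :: _]cat0s; case/and5P => _ _ _ _.
  - by apply: clb; rewrite mem_head.
  - by move=> y yc; apply: clb; rewrite inE yc orbT.
  - by apply/allP; rewrite /= a34 a35 a36.
have tb z : z \in [:: x0; x1; x2] -> col z = Some b.
  move=> zt; have zs : z \in s by rewrite -[s]/([:: x0; x1; x2] ++ _) mem_cat zt.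
  have ys : y \in s by rewrite -[s]/([:: x0; x1; x2] ++ _) mem_cat yc orbT.
  apply: B => //; apply/eqP => zN; have E := one z y zs ys zN yN; subst y.
  move: Us; rewrite -[s]/([:: x0; x1; x2] ++ [:: x3; x4; x5; x6]) cat_uniq.
  by case/and3P => _ /hasPn/(_ z yc); rewrite zt.
by apply: (no_K3 _ _ _ a01 a12 a02); apply: tb; rewrite !inE eqxx ?orbT.
Qed.

Lemma template_claw_C4 : ~~ contains G (sgraph_of claw_C4).
Proof.
apply: no_gadget => // -[|x0 [|x1 [|x2 [|x3 [|x4 [|x5 [|x6 [|x7 [|]]]]]]]]] // Us _ /(_ x0).
move=> /= /and5P[a01 a12 a23 a03 /and4P[a45 a46 a47 _]].
set s := [:: x0; _; _; _; _; _; _; _] in Us *.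
have sE : s = [:: x0; x1; x2; x3] ++ [:: x4; x5; x6; x7] by [].
have [U1 U12 U2] : [/\ uniq [:: x0; x1; x2; x3],
    forall z, z \in [:: x4; x5; x6; x7] -> z \notin [:: x0; x1; x2; x3]
    & uniq [:: x4; x5; x6; x7]].
  by move: Us; rewrite sE cat_uniq => /and3P[? /hasPn ? ?].
clearbody s; subst s.
split=> [N|b B one].
  have {}N y : y \in [:: x0; x1; x2; x3] -> col y = None.
    by move=> yc; apply: N; rewrite mem_cat yc.
  apply: (tm_C4 tm (x := x0) (x' := x2) (y := x1) (y' := x3)) => //;
    try by [apply: N; rewrite !inE eqxx ?orbT | rewrite adj_sym].
  - by move: U1; rewrite /= !inE; case: (x0 == x2); rewrite ?orbT.
  - by move: U1; rewrite /= !inE; case: (x1 == x3); rewrite ?orbT ?andbF.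
(* The same distinction as for [claw_C3]; a 4-cycle in the part [Some b] would have two disjoint
   edges, which a star has not. *)
have [/allP cl|/allPn[y yc /negPn/eqP yN]] := boolP (all (fun x => col x != None) [:: x4; x5; x6; x7]).
  have clb y : y \in [:: x4; x5; x6; x7] -> col y = Some b.
    by move=> yc; apply: B; [rewrite mem_cat yc orbT|apply: cl].
  apply: (@no_claw b x4 [:: x5; x6; x7]) => //.
  - by case/andP: U2.
  - by apply: clb; rewrite mem_head.
  - by move=> y yc; apply: clb; rewrite inE yc orbT.
  - by apply/allP; rewrite /= a45 a46 a47.
have tb z : z \in [:: x0; x1; x2; x3] -> col z = Some b.
  move=> zt; apply: B; first by rewrite mem_cat zt.
  apply/eqP => zN; have := U12 y yc.
  by rewrite -(one z y _ _ zN yN) ?zt // mem_cat ?zt ?yc ?orbT.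
by apply: (no_2K2 _ _ _ _ U1 a01 a23); apply: tb; rewrite !inE eqxx ?orbT.
Qed.

(** Two triangles sharing a vertex: the removal of any single vertex leaves a triangle or two
    disjoint edges, and a star contains neither. *)
Lemma template_cone_2K2 : ~~ contains G (sgraph_of cone_2K2).
Proof.
apply: no_gadget => // -[|x0 [|x1 [|x2 [|x3 [|x4 [|]]]]]] // Us _ /(_ x0).
move=> /= /and5P[a01 a02 a03 a04 /and3P[a12 a34 _]].
set s := [:: x0; x1; x2; x3; x4].
have s0 : x0 \in s by rewrite !inE eqxx.
have s1 : x1 \in s by rewrite !inE eqxx ?orbT.
have s2 : x2 \in s by rewrite !inE eqxx ?orbT.
have s3 : x3 \in s by rewrite !inE eqxx ?orbT.
have s4 : x4 \in s by rewrite !inE eqxx ?orbT.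
split=> [N|b B one].
  by apply: (tm_C3 tm _ _ _ a01 a12 a02); apply: N.
have dist x y : x \in s -> y \in s -> x != y -> col x = None -> col y = Some b.
  move=> xs ys xy xN; apply: B => //; apply: contraNneq xy => yN.
  by apply/eqP/one.
have U : uniq [:: x1; x2; x3; x4] by case/andP: Us.
have [|x0b] := eqVneq (col x0) None.
  move=> /dist N; have n0 y : y \in [:: x1; x2; x3; x4] -> x0 != y.
    by case/andP: Us => + _ ys; apply: contraNneq => ->.
  by apply: (no_2K2 _ _ _ _ U a12 a34); apply: N; rewrite // n0 // !inE eqxx ?orbT.
have {x0b}x0b := B _ s0 x0b.
have [|x1b] := eqVneq (col x1) None.
  move=> /dist N; have n1 y : y \in [:: x2; x3; x4] -> x1 != y.
    by case/andP: U => + _ ys; apply: contraNneq => ->.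
  by apply: (no_K3 x0b _ _ a03 a34 a04); apply: N; rewrite // n1 // !inE eqxx ?orbT.
have [|x2b] := eqVneq (col x2) None.
  move=> /dist N; have n2 y : y \in [:: x3; x4] -> x2 != y.
    by case/and3P: U => _ + _ ys; apply: contraNneq => ->.
  by apply: (no_K3 x0b _ _ a03 a34 a04); apply: N; rewrite // n2 // !inE eqxx ?orbT.
exact: (no_K3 x0b (B _ s1 x1b) (B _ s2 x2b) a01 a12 a02).
Qed.

(** The removal of x0 or x1 leaves a claw centred at the other of them; the removal of any other
    vertex leaves a triangle. *)
Lemma template_cone_claw : ~~ contains G (sgraph_of cone_claw).
Proof.
apply: no_gadget => // -[|x0 [|x1 [|x2 [|x3 [|x4 [|]]]]]] // Us _ /(_ x0).
move=> /= /and5P[a01 a02 a03 a04 /and4P[a12 a13 a14 _]].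
set s := [:: x0; x1; x2; x3; x4].
have s0 : x0 \in s by rewrite !inE eqxx.
have s1 : x1 \in s by rewrite !inE eqxx ?orbT.
have s2 : x2 \in s by rewrite !inE eqxx ?orbT.
have s3 : x3 \in s by rewrite !inE eqxx ?orbT.
have s4 : x4 \in s by rewrite !inE eqxx ?orbT.
split=> [N|b B one].
  by apply: (tm_C3 tm _ _ _ a01 a12 a02); apply: N.
have dist x y : x \in s -> y \in s -> x != y -> col x = None -> col y = Some b.
  move=> xs ys xy xN; apply: B => //; apply: contraNneq xy => yN.
  by apply/eqP/one.
have U : uniq [:: x2; x3; x4] by case/and3P: Us.
have sub y : y \in [:: x2; x3; x4] -> y \in s by move=> ys; rewrite 2!inE ys !orbT.
have [|x0b] := eqVneq (col x0) None.
  move=> /dist N; apply: (@no_claw b x1 [:: x2; x3; x4]) => //.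
  - by apply: N => //; apply: adj_neq a01.
  - by move=> y; rewrite !inE => /or3P[]/eqP->; apply: N => //;
      [apply: adj_neq a02 | apply: adj_neq a03 | apply: adj_neq a04].
  - by apply/allP; rewrite /= a12 a13 a14.
have {x0b}x0b := B _ s0 x0b.
have [|x1b] := eqVneq (col x1) None.
  move=> /dist N; apply: (@no_claw b x0 [:: x2; x3; x4]) => //.
  - by move=> y; rewrite !inE => /or3P[]/eqP->; apply: N => //;
      [apply: adj_neq a12 | apply: adj_neq a13 | apply: adj_neq a14].
  - by apply/allP; rewrite /= a02 a03 a04.
have {x1b}x1b := B _ s1 x1b.
have [|x2b] := eqVneq (col x2) None; last first.
  exact: (no_K3 x0b x1b (B _ s2 x2b) a01 a12 a02).
move=> /dist N; apply: (no_K3 x0b x1b (N x3 _ _ _) a01 a13 a03) => //.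
by move: U; rewrite /= inE; case: (x2 == x3).
Qed.

Lemma template_free : is_free forbidden G.
Proof.
apply/and5P; split; [exact: template_apex | exact: template_K6 |
  exact: template_claw_C3 | exact: template_claw_C4 | apply/andP; split].
  exact: template_cone_2K2.
by apply/andP; split; first exact: template_cone_claw.
Qed.

End Template.

(** * Improving a free graph that is a join of three parts *)

Lemma set2_inj (T : finType) (x y a b : T) : [set x; y] = [set a; b] ->
  (x = a /\ y = b) \/ (x = b /\ y = a).
Proof.
move=> E.
have: x \in [set a; b] by rewrite -E set21.
have: y \in [set a; b] by rewrite -E set22.
have: a \in [set x; y] by rewrite E set21.
have: b \in [set x; y] by rewrite E set22.
rewrite !inE => /orP[]/eqP E1 /orP[]/eqP E2 /orP[]/eqP E3 /orP[]/eqP E4;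
  subst; by [left | right].
Qed.

Section Join.
Variables (V : finType) (G : sgraph V).
Implicit Types (S U : {set V}) (col : V -> option bool).

Definition part col c := [set x | col x == c].

(** Deleting [U] costs at most 8 |V| arcs, and if all remaining degrees were at most 6 there would
    be at most 14 |V| arcs in total. Degree 7 is asked for so that a neighbourhood can serve as a
    side of K_{7,7}. *)
Lemma star_avoiding S U : #|U| <= 4 -> 15 * #|V| < arcs G S S ->
  exists z, [/\ z \in S, z \notin U & 7 <= #|nbhd G (S :\: U) z|].
Proof.
move=> U4 dense.
suff /existsP[z /and3P[zS zU z7]] :
    [exists z, [&& z \in S, z \notin U & 7 <= #|nbhd G (S :\: U) z|]] by exists z.
apply: contraTT dense => /existsPn no.
have US : S :&: U \subset S by apply: subsetIl.
have DE : S :\: (S :&: U) = S :\: U.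
  by apply/setP => x; rewrite !inE; case: (x \in S); rewrite ?andbF ?andbT.
have := arcs_delete G US; rewrite DE.
have le6 : arcs G (S :\: U) (S :\: U) <= #|S :\: U| * 6.
  apply: arcs_le => x; rewrite inE => /andP[xU xS].
  by have := no x; rewrite xU xS /= -ltnNge.
have := max_card (S :\: U); have := subset_leq_card (subsetIr S U); nia.
Qed.

Hypothesis G_free : is_free forbidden G.

Lemma no_apex : ~~ contains G (sgraph_of apex_4K4).
Proof. by case/andP: G_free. Qed.

Lemma no_K6 : ~~ contains G (sgraph_of K6).
Proof. by case/and3P: G_free. Qed.

Lemma no_claw_C3 : ~~ contains G (sgraph_of claw_C3).
Proof. by case/and4P: G_free. Qed.

Lemma no_claw_C4 : ~~ contains G (sgraph_of claw_C4).
Proof. by case/and5P: G_free. Qed.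

Lemma no_cone_2K2 : ~~ contains G (sgraph_of cone_2K2).
Proof. by case/and5P: G_free => _ _ _ _ /andP[]. Qed.

Lemma no_cone_claw : ~~ contains G (sgraph_of cone_claw).
Proof. by case/and5P: G_free => _ _ _ _ /and3P[]. Qed.

Section Colored.
Variable col : V -> option bool.
Hypothesis col_join : forall x y, col x != col y -> adj G x y.
Let P := part col.

Lemma join_part b c x y : x \in P b -> y \in P c -> b != c -> adj G x y.
Proof. by rewrite !inE => /eqP xb /eqP yc bc; apply: col_join; rewrite xb yc. Qed.

Lemma part_big c v : 2 * #|V| ^ 2 + 150 * #|V| < 6 * #|edges G| ->
  v \in P c -> 7 <= #|P c|.
Proof.
move=> large vc; rewrite leqNgt; apply/negP => small.
have DE : setT :\: P c = ~: P c by rewrite setTD.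
have vN : ~: P c \subset nbhd G setT v.
  apply/subsetP => x; rewrite !inE /= => xc; apply: col_join.
  by move: vc; rewrite inE => /eqP ->; rewrite eq_sym.
(* Four disjoint K_4 outside the part of [v] would form an [apex_4K4] with apex [v]. *)
case: (disjoint_cliques G 4 (~: P c)) => [[f [fS fc fd]]|[U [US U4 UQ]]].
  move/negP: no_apex; apply; apply: (contains_apex (v := v) (f := f)) => // i i4.
  by have [cl f4] := fc i i4; split=> //; apply: subset_trans (fS i i4) vN.
(* At most 6 + 16 vertices are deleted, at a cost of 44 n arcs. With the bound 2n^2/3 for the
   K_4-free rest, 6 [#|edges G|] is at most 2n^2 + 132 n. *)
have := turan_bound UQ; have := arcs_delete G US.
have := arcs_delete G (subsetT (P c)); rewrite DE handshake.
have := max_card (~: P c :\: U); rewrite /=.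
move: large small U4.
move: (arcs _ _ _) (arcs _ _ _) (#|edges G|) (#|P c|) (#|U|) (#|V|) (#|~: P c :\: U|).
move=> a b e p u n w; nia.
Qed.

Lemma arcs_parts : arcs G setT setT <=
  \sum_c (arcs G (P c) (P c) + #|P c| * (#|V| - #|P c|)).
Proof.
have -> : arcs G setT setT = \sum_c arcs G (P c) setT.
  rewrite /arcs (partition_big col xpredT) //=; apply: eq_bigr => c _.
  by apply: eq_bigl => x; rewrite !inE.
apply: leq_sum => c _; rewrite (arcs_splitr _ _ (subsetT (P c))) leq_add2l.
apply: arcs_le => x _; apply: leq_trans (nbhd_le _ _ _) _.
by rewrite setTD cardsCs setCK.
Qed.

(** If every part spanned at most 15 n arcs, the sizes x, y, z of the parts would give 2
    [#|edges G|] at most 45 n + 2(xy + yz + zx), and xy + yz + zx is at most n^2/3. *)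
Lemma dense_part : 2 * #|V| ^ 2 + 150 * #|V| < 6 * #|edges G| ->
  exists c, 15 * #|V| < arcs G (P c) (P c).
Proof.
clear G_free; move=> large; apply/existsP; apply: contraTT large => /existsPn no.
have := arcs_parts; rewrite handshake sum_colors -leqNgt.
have : #|V| = \sum_c #|P c|.
  rewrite -cardsT (card_colors col); apply: eq_bigr => c _.
  by apply: eq_card => x; rewrite !inE.
rewrite sum_colors.
have := no None; have := no (Some true); have := no (Some false); rewrite -!leqNgt.
move: (arcs _ _ _) (arcs _ _ _) (arcs _ _ _) (#|P _|) (#|P _|) (#|P _|) (#|V|) (#|edges G|).
move=> a b c x y z n e fb tb Nb n_eq.
have -> : n - x = y + z by lia.
have -> : n - y = x + z by lia.
have -> : n - z = x + y by lia.
have := (nat_Cauchy x y).1; have := (nat_Cauchy y z).1; have := (nat_Cauchy x z).1.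
have -> : n ^ 2 = x ^ 2 + y ^ 2 + z ^ 2 + 2 * (x * y) + 2 * (y * z) + 2 * (x * z).
  by rewrite n_eq; ring.
rewrite !mulnDr (mulnC y x) (mulnC z x) (mulnC z y); lia.
Qed.

Section Dense.
Hypothesis dense : 15 * #|V| < arcs G (P None) (P None).
Hypothesis big : forall b, 7 <= #|P (Some b)|.

(** The parts [Some true] and [Some false] supply the K_{7,7} joined to everything in A. *)
Lemma gadget_None q e : all (fun p => p.1 < p.2 < q) e ->
  ~~ contains G (sgraph_of (gadget q e)) ->
  forall s : seq V, uniq s -> size s = q -> {subset s <= P None} ->
  (forall x0, all (fun p => adj G (nth x0 s p.1) (nth x0 s p.2)) e) -> False.
Proof.
move=> eq /negP no s Us sq sN se; apply/no/(contains_gadgetP _ eq).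
exists s, (fun b => P (Some b)); split=> //; split=> [x b y /sN xP yP|x y xP yP]; exact: join_part xP yP isT.
Qed.

Lemma claw_avoiding U : #|U| <= 4 -> exists s : seq V,
  [/\ uniq s, size s = 4, {subset s <= P None :\: U} &
      {in behead s, forall y x0, adj G (head x0 s) y}].
Proof.
move=> U4; have [z [zP zU]] := star_avoiding U4 dense.
move=> /(leq_trans (isT : 3 <= 7))/card_geqP[s [Us s3 sN]].
exists (z :: s); split=> /=; last by move=> y /sN; rewrite inE => /andP[].
- rewrite Us andbT; apply/negP => /sN; by rewrite inE adj_irrefl andbF.
- by rewrite s3.
- move=> x; rewrite inE => /predU1P[->|/sN]; first by rewrite inE zU zP.
  by rewrite inE => /andP[].
Qed.

(** A claw of A disjoint from the triangle would complete it to the core of [claw_C3]. *)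
Lemma None_C3_free x y z : col x = None -> col y = None -> col z = None ->
  adj G x y -> adj G y z -> adj G x z -> False.
Proof.
move=> xN yN zN xy yz xz.
have U : uniq [:: x; y; z].
  by rewrite /= !inE (negPf (adj_neq xy)) (negPf (adj_neq xz)) (negPf (adj_neq yz)).
have [|s [Us s4 sP sa]] := @claw_avoiding [set u in [:: x; y; z]].
  by rewrite cardsE (card_uniqP U).
case: s Us s4 sP sa => [|t [|t1 [|t2 [|t3 [|]]]]] // Ut _ tP ta.
apply: (gadget_None _ no_claw_C3 (s := [:: x; y; z] ++ [:: t; t1; t2; t3])) => //.
- rewrite cat_uniq U Ut andbT; apply/hasPn => u /tP.
  by rewrite inE => /andP[+ _]; rewrite inE.
- move=> u; rewrite mem_cat => /orP[|/tP]; last by rewrite inE => /andP[].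
  by rewrite !inE => /or3P[]/eqP->; apply/eqP.
- by move=> x0 /=; rewrite xy yz xz !(ta _ _ x0) ?inE ?eqxx ?orbT.
Qed.

Lemma None_C4_free x x' y y' : col x = None -> col x' = None ->
  col y = None -> col y' = None -> x != x' -> y != y' ->
  adj G x y -> adj G x y' -> adj G x' y -> adj G x' y' -> False.
Proof.
move=> xN x'N yN y'N xx' yy' xy xy' x'y x'y'.
have U : uniq [:: x; y; x'; y'].
  rewrite /= !inE (negPf xx') (negPf yy') (negPf (adj_neq xy)) (negPf (adj_neq xy')).
  by rewrite eq_sym (negPf (adj_neq x'y)) (negPf (adj_neq x'y')).
have [|s [Us s4 sP sa]] := @claw_avoiding [set u in [:: x; y; x'; y']].
  by rewrite cardsE (card_uniqP U).
case: s Us s4 sP sa => [|t [|t1 [|t2 [|t3 [|]]]]] // Ut _ tP ta.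
apply: (gadget_None _ no_claw_C4 (s := [:: x; y; x'; y'] ++ [:: t; t1; t2; t3])) => //.
- rewrite cat_uniq U Ut andbT; apply/hasPn => u /tP.
  by rewrite inE => /andP[+ _]; rewrite inE.
- move=> u; rewrite mem_cat => /orP[|/tP]; last by rewrite inE => /andP[].
  by rewrite !inE => /or4P[]/eqP->; apply/eqP.
- move=> x0 /=; rewrite xy xy' x'y' !(ta _ _ x0) ?inE ?eqxx ?orbT //.
  by rewrite adj_sym x'y.
Qed.

(** The apex of the cone is a vertex [z] of A with 7 neighbours in A. These neighbours and the third
    part are the sides of the K_{7,7}. *)
Lemma cone_Some b q e : all (fun p => p.1 < p.2 < q.+1) e ->
  ~~ contains G (sgraph_of (gadget q.+1 e)) ->
  forall s : seq V, uniq s -> size s = q -> {subset s <= P (Some b)} ->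
  (forall z x0, {in s, forall y, adj G z y} ->
    all (fun p => adj G (nth x0 (z :: s) p.1) (nth x0 (z :: s) p.2)) e) -> False.
Proof.
move=> eq /negP no s Us sq sP se; apply/no/(contains_gadgetP _ eq).
have [|z [zP _]] := star_avoiding (U := set0) _ dense; first by rewrite cards0.
rewrite setD0 => z7; exists (z :: s).
have zs : {in s, forall y, adj G z y} by move=> y /sP yP; apply: join_part zP yP isT.
have N7 y : y \in nbhd G (P None) z -> y \in P None by rewrite inE => /andP[].
exists (fun c => if c then nbhd G (P None) z else P (Some (~~ b))); split.
- rewrite /= Us andbT; apply/negP => /sP.
  by move: zP; rewrite !inE => /eqP ->.
- by rewrite /= sq.
- by move=> x0; apply: se.
- by case.
split=> [x [] y|x y /N7 xP yP]; last exact: join_part xP yP isT.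
  rewrite inE => /predU1P[-> |/sP xP]; first by rewrite inE => /andP[].
  by move=> /N7 yP; apply: join_part xP yP isT.
rewrite inE => /predU1P[-> |/sP xP] yP; first exact: join_part zP yP isT.
by apply: join_part xP yP _; case: (b).
Qed.

Lemma Some_no_2K2 b x y z t : uniq [:: x; y; z; t] ->
  {subset [:: x; y; z; t] <= P (Some b)} -> adj G x y -> adj G z t -> False.
Proof.
move=> U sP xy zt; apply: (cone_Some _ no_cone_2K2 U _ sP) => // v x0 vs /=.
by rewrite xy zt !vs ?inE ?eqxx ?orbT.
Qed.

Lemma Some_no_claw b x y z t : uniq [:: x; y; z; t] ->
  {subset [:: x; y; z; t] <= P (Some b)} ->
  adj G x y -> adj G x z -> adj G x t -> False.
Proof.
move=> U sP xy xz xt; apply: (cone_Some _ no_cone_claw U _ sP) => // v x0 vs /=.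
by rewrite xy xz xt !vs ?inE ?eqxx ?orbT.
Qed.

Lemma dense_edge : exists x y, [/\ x \in P None, y \in P None & adj G x y].
Proof.
have [|x [xP _]] := star_avoiding (U := set0) _ dense; first by rewrite cards0.
move=> /(leq_trans (isT : 0 < 7))/card_gt0P[y]; rewrite setD0 inE => /andP[yP xy].
by exists x, y.
Qed.

Lemma clique6 (s : seq V) : size s = 6 -> pairwise (adj G) s -> False.
Proof.
move=> s6 sp; move/negP: no_K6; apply; apply/contains_K6P; exists s; split=> //.
  by apply: pairwise_uniq sp => x; apply: adj_irrefl.
(* [pairwise] only relates earlier to later entries; the reflexive closure of adjacency is symmetric
   and reflexive, which extends it to all pairs. *)
pose r x y := (x == y) || adj G x y.
have: pairwise r s by apply: sub_pairwise sp => x y; rewrite /r orbC => ->.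
rewrite pairwise_all2rel; first last.
- by move=> x y; rewrite /r eq_sym adj_sym.
- by move=> x; rewrite /r eqxx.
move=> /allrelP H x y xs ys xy; have := H x y xs ys.
by rewrite /r (negPf xy).
Qed.

(** The triangle, an edge of A and a vertex of the third part would span a K_6. *)
Lemma Some_no_K3 b x y z : {subset [:: x; y; z] <= P (Some b)} ->
  adj G x y -> adj G y z -> adj G x z -> False.
Proof.
move=> sP xy yz xz; have [u [v [uP vP uv]]] := dense_edge.
have [t tP] : exists t, t \in P (Some (~~ b)).
  by apply/card_gt0P; apply: leq_trans (big _).
have [xP yP zP] : [/\ x \in P (Some b), y \in P (Some b) & z \in P (Some b)].
  by split; apply: sP; rewrite !inE eqxx ?orbT.
have bb : Some b != Some (~~ b) by case: (b).
have au c r (rP : r \in P (Some c)) := join_part uP rP isT.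
have av c r (rP : r \in P (Some c)) := join_part vP rP isT.
have ab r r' (rP : r \in P (Some b)) (rP' : r' \in P (Some (~~ b))) :=
  join_part rP rP' bb.
apply: (@clique6 [:: u; v; x; y; z; t]) => //=.
by rewrite uv (au _ _ xP) (au _ _ yP) (au _ _ zP) (au _ _ tP) (av _ _ xP)
  (av _ _ yP) (av _ _ zP) (av _ _ tP) xy xz (ab _ _ xP tP) yz (ab _ _ yP tP) (ab _ _ zP tP).
Qed.

(** One edge in each of the three parts would span a K_6. *)
Lemma Some_edges_one_part b x y z t :
  x \in P (Some b) -> y \in P (Some b) -> adj G x y ->
  z \in P (Some (~~ b)) -> t \in P (Some (~~ b)) -> adj G z t -> False.
Proof.
move=> xP yP xy zP tP zt; have [u [v [uP vP uv]]] := dense_edge.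
have bb : Some b != Some (~~ b) by case: (b).
have au c r (rP : r \in P (Some c)) := join_part uP rP isT.
have av c r (rP : r \in P (Some c)) := join_part vP rP isT.
have ab r r' (rP : r \in P (Some b)) (rP' : r' \in P (Some (~~ b))) :=
  join_part rP rP' bb.
apply: (@clique6 [:: u; v; x; y; z; t]) => //=.
by rewrite uv (au _ _ xP) (au _ _ yP) (au _ _ zP) (au _ _ tP) (av _ _ xP)
  (av _ _ yP) (av _ _ zP) (av _ _ tP) xy (ab _ _ xP zP) (ab _ _ xP tP) (ab _ _ yP zP) (ab _ _ yP tP) zt.
Qed.

Definition inner b := [set e in edges G | e \subset P (Some b)].

Lemma innerP b e x : e \in inner b -> x \in e ->
  exists y, [/\ e = [set x; y], adj G x y, x \in P (Some b) & y \in P (Some b)].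
Proof.
rewrite inE => /andP[/edgesP[u [v [uv ->]]]].
rewrite subUset !sub1set => /andP[uP vP] /set2P[]->.
  by exists v.
by exists u; rewrite setUC adj_sym.
Qed.

Lemma inner_meet b e f : e \in inner b -> f \in inner b ->
  exists x, x \in e /\ x \in f.
Proof.
move=> eI fI.
have [x [y [xy E]]] : exists x y, adj G x y /\ e = [set x; y].
  by apply/edgesP; move: eI; rewrite inE => /andP[].
have [z [t [zt F]]] : exists x y, adj G x y /\ f = [set x; y].
  by apply/edgesP; move: fI; rewrite inE => /andP[].
have [/pred0Pn[u /andP[ue uf]]|] := boolP (~~ [disjoint e & f]); first by exists u.
rewrite negbK => dis; exfalso.
have sub u : u \in [:: x; y; z; t] -> u \in P (Some b).
  rewrite -[_ :: _]/([:: x; y] ++ [:: z; t]) mem_cat.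
  move: eI fI; rewrite !inE E F !subUset !sub1set !inE.
  by do 2!case/and3P=> _ /eqP ? /eqP ?; case/orP => /orP[]/eqP->; apply/eqP.
apply: (Some_no_2K2 _ sub xy zt).
rewrite -[_ :: _]/([:: x; y] ++ [:: z; t]) cat_uniq /= !inE !andbT.
rewrite (adj_neq xy) (adj_neq zt) andbT orbF negb_or.
have zf : z \in f by rewrite F set21.
have tf : t \in f by rewrite F set22.
move/pred0P: dis => dis; move: (dis z) (dis t).
by rewrite /= zf tf !andbT E !inE => -> ->.
Qed.

(** Any two edges inside the part meet, so three of them would form a claw or a triangle. *)
Lemma inner_le2 b : #|inner b| <= 2.
Proof.
rewrite leqNgt; apply/negP => /card_gt2P[e [f [g [[eI fI gI] [ef fg ge]]]]].
have [x [xe xf]] := inner_meet eI fI.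
have [y [E xy xP yP]] := innerP eI xe; have [z [F xz _ zP]] := innerP fI xf.
have yz : y != z by apply: contraNneq ef => yz; rewrite E F yz.
have [xg|xg] := boolP (x \in g).
  have [t [Eg xt _ tP]] := innerP gI xg.
  apply: (Some_no_claw (b := b) (x := x) (y := y) (z := z) (t := t)) => //.
    rewrite /= !inE (negPf (adj_neq xy)) (negPf (adj_neq xz)) (negPf (adj_neq xt)).
    rewrite (negPf yz) /= andbT; apply/andP; split.
      by apply: contraNneq ge => yt; rewrite Eg E yt.
    by apply: contraNneq fg => zt; rewrite Eg F zt.
  by move=> u; rewrite !inE => /or4P[]/eqP->; apply/eqP; move: xP yP zP tP;
    rewrite !inE => /eqP ? /eqP ? /eqP ? /eqP ?.
have yg : y \in g.
  have [u []] := inner_meet eI gI; rewrite E !inE => /orP[]/eqP-> //.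
  by rewrite (negPf xg).
have zg : z \in g.
  have [u []] := inner_meet fI gI; rewrite F !inE => /orP[]/eqP-> //.
  by rewrite (negPf xg).
have yz' : adj G y z.
  have [t [Eg yt _ _]] := innerP gI yg.
  by move: zg; rewrite Eg !inE eq_sym (negPf yz) => /eqP ->.
apply: (Some_no_K3 (b := b) _ xy yz' xz) => u.
by rewrite !inE => /or3P[]/eqP->; move: xP yP zP; rewrite !inE.
Qed.

Lemma inner_one_part b : inner b != set0 -> inner (~~ b) = set0.
Proof.
move=> /set0Pn[e eI]; apply/setP => f; rewrite in_set0; apply/negP => fI.
have [x xe] : exists x, x \in e.
  have := eI; rewrite inE => /andP[/edgesP[x [y [_ ->]]] _].
  by exists x; rewrite set21.
have [u uf] : exists u, u \in f.
  have := fI; rewrite inE => /andP[/edgesP[u [v [_ ->]]] _].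
  by exists u; rewrite set21.
have [y [_ xy xP yP]] := innerP eI xe; have [v [_ uv uP vP]] := innerP fI uf.
exact: (Some_edges_one_part xP yP xy uP vP uv).
Qed.

Lemma inners_le2 : #|inner true :|: inner false| <= 2.
Proof.
have [->|/inner_one_part ->] := eqVneq (inner true) set0.
  by rewrite set0U inner_le2.
by rewrite setU0 inner_le2.
Qed.

(* The inner edges are replaced by one star with two edges in each of the parts
   Some true and Some false, whose centres are made nonadjacent. *)
Lemma improve : exists G' : sgraph V,
  is_free forbidden G' /\ #|edges G| < #|edges G'|.
Proof.
have pick3 b : exists t : V * V * V, [&& t.1.1 \in P (Some b), t.1.2 \in P (Some b),
    t.2 \in P (Some b), t.1.1 != t.1.2, t.1.1 != t.2 & t.1.2 != t.2].
  have /card_gt2P[x [y [z [[xP yP zP] [xy yz zx]]]]] : 2 < #|P (Some b)|.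
    by apply: leq_trans (big b).
  by exists (x, y, z); rewrite /= xP yP zP xy yz eq_sym zx.
pose tr b := xchoose (pick3 b).
pose h b := (tr b).1.1; pose u b := (tr b).1.2; pose w b := (tr b).2.
have hP b : [/\ h b \in P (Some b), u b \in P (Some b) & w b \in P (Some b)].
  by have /and4P[] := xchooseP (pick3 b).
have dist b : [/\ h b != u b, h b != w b & u b != w b].
  by have /and4P[_ _ _ /and3P[]] := xchooseP (pick3 b).
clearbody h u w; clear pick3 tr.
(* The four new edges are indexed by pairs: the first boolean is the part, the second selects the
   leaf. *)
pose leaf (a : bool * bool) := if a.2 then u a.1 else w a.1.
pose N := [set [set h a.1; leaf a] | a : bool * bool].
have leafP a : leaf a \in P (Some a.1) by rewrite /leaf; case: (hP a.1); case: a.2.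
have hleaf a : h a.1 != leaf a by rewrite /leaf; case: (dist a.1); case: a.2.
have colh b : col (h b) = Some b by case: (hP b); rewrite inE => /eqP.
have colleaf a : col (leaf a) = Some a.1 by have := leafP a; rewrite inE => /eqP.
have N4 : #|N| = 4.
  rewrite card_imset ?card_prod ?card_bool // => a b /set2_inj E.
  have E1 : a.1 = b.1.
    by case: E => [[/(congr1 col)]|[/(congr1 col)]]; rewrite !(colh, colleaf) => -[].
  case: E => [[_]|[hl _]]; last by have := hleaf b; rewrite -hl E1 eqxx.
  case: (dist a.1) => _ _ uw; move: E1 uw; rewrite /leaf.
  case: a b => [a c] [b d] /= -> uw; case: c d => [] [] // E.
    by rewrite E eqxx in uw.
  by rewrite E eqxx in uw.
pose I := inner true :|: inner false.
pose E' := (edges G :\ [set h true; h false]) :\: I :|: N.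
have E'2 : [forall e in E', #|e| == 2].
  apply/forall_inP => e; rewrite inE => /orP[|/imsetP[a _ ->]]; last first.
    by rewrite cards2 hleaf.
  by rewrite !inE => /andP[_ /andP[_ eG]]; apply: (forall_inP (edges_card2 G)).
pose G' := SGraph E'2.
have adj' x y : adj G' x y -> adj G x y \/ [set x; y] \in N.
  rewrite {1}/adj /= inE => /orP[|->]; last by right.
  by rewrite !inE => /andP[_ /andP[_ xyG]]; left.
have inN b x y : col x = Some b -> [set x; y] \in N ->
    (x = h b /\ y \in [set u b; w b]) \/ (y = h b /\ x \in [set u b; w b]).
  move=> xb /imsetP[a _ /set2_inj E].
  have ab : a.1 = b.
    by move: xb; case: E => [[-> _]|[-> _]]; rewrite !(colh, colleaf) => -[].
  have lf : leaf a \in [set u b; w b].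
    by rewrite /leaf -ab; case: a.2; rewrite !inE eqxx ?orbT.
  by rewrite -ab in lf *; case: E => [[-> ->]|[-> ->]]; [left|right].
(* All old edges inside the parts [Some b] are removed, so only the new stars remain there. *)
have innerN b x y : col x = Some b -> col y = Some b -> adj G' x y ->
    [set x; y] \in N.
  move=> xb yb; rewrite {1}/adj /= inE => /orP[|//].
  rewrite !inE negb_or => /andP[/andP[t f] /andP[_ xyG]].
  have : [set x; y] \in inner b.
    by rewrite inE xyG subUset !sub1set !inE xb yb eqxx.
  by rewrite inE => xyI; move: t f; case: (b) xyI => ->.
have adjN x y : col x = None -> adj G' x y -> adj G x y.
  move=> xN /adj'[//|/imsetP[a _ /set2_inj E]].
  by move: xN; case: E => [[-> _]|[-> _]]; rewrite !(colh, colleaf).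
exists G'; split.
  apply: (@template_free _ G' col h); split.
  - move=> x y z xN yN zN /(adjN _ _ xN) xy /(adjN _ _ yN) yz /(adjN _ _ xN).
    exact: None_C3_free xy yz.
  - move=> x x' y y' xN x'N yN y'N xx' yy' /(adjN _ _ xN) xy /(adjN _ _ xN) xy'.
    move=> /(adjN _ _ x'N) x'y /(adjN _ _ x'N).
    exact: None_C4_free xy xy' x'y.
  - move=> b x y xb yb /(innerN _ _ _ xb yb)/(inN _ _ _ xb).
    by case=> -[-> _]; [left|right].
  - move=> b x xb; have [xh|xh] := eqVneq x (h b).
      apply: leq_trans (_ : #|[set u b; w b]| <= _); last by rewrite cards2; case: eqP.
      apply/subset_leq_card/subsetP => y; rewrite !inE => /andP[/eqP yb].
      move=> /(innerN _ _ _ xb yb)/(inN _ _ _ xb)[[_]|[_]]; first by rewrite !inE.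
      by rewrite xh !inE; case: (dist b) => /negPf-> /negPf->.
    apply: leq_trans (_ : #|[set h b]| <= _); last by rewrite cards1.
    apply/subset_leq_card/subsetP => y; rewrite !inE => /andP[/eqP yb].
    move=> /(innerN _ _ _ xb yb)/(inN _ _ _ xb)[[]|[-> _]]; last by rewrite eqxx.
    by move=> E; rewrite E eqxx in xh.
  - rewrite /adj /= inE negb_or !inE eqxx /= andbF /=.
    apply/negP => /(inN true _ _ (colh true))[[_]|[hh _]]; last first.
      by have := colh false; rewrite hh colh.
    have [_ uP wP] := hP true; move: uP wP; rewrite !inE => /eqP ut /eqP wt.
    by case/orP => /eqP E; have := colh false; rewrite E ?ut ?wt.
have NE : N \subset E' by apply: subsetUr.
have := cardsID N E'; rewrite (setIidPr NE) N4 => <-.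
have NI e : e \in edges G -> e \in N -> e \in I.
  move=> eG /imsetP[a _ E]; rewrite inE !inE eG E !subUset !sub1set !inE.
  by rewrite colh colleaf; case: a.1.
(* Four edges are gained; at most three are lost, namely two inner ones and the one between the
   centres. *)
have sub : edges G \subset (E' :\: N) :|: ([set h true; h false] |: I).
  apply/subsetP => e eG; rewrite in_setU in_setU1 in_setD /E' in_setU in_setD in_setD1 eG andbT.
  have [/(NI _ eG) ->|_] := boolP (e \in N); first by rewrite !orbT.
  by case: (e \in I); case: eqP.
have := subset_leq_card sub; have := (leq_card_setU (E' :\: N) ([set h true; h false] |: I)).1.
have := inners_le2; rewrite -/I cardsU1.
move: (#|_|) (#|_|) (#|_|) (_ \notin _) (#|_|) => p q r [] v /=; lia.
Qed.

End Dense.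
End Colored.
End Join.

Lemma join_not_extremal (V : finType) (G : sgraph V) (col : V -> option bool) :
  is_free forbidden G -> (forall c, exists x, col x = c) ->
  (forall x y, col x != col y -> adj G x y) ->
  2 * #|V| ^ 2 + 150 * #|V| < 6 * #|edges G| ->
  exists G' : sgraph V, is_free forbidden G' /\ #|edges G| < #|edges G'|.
Proof.
move=> Gf surj join large; have [c dense] := dense_part col large.
(* A transposition of the colours turns the dense part into the part [None]. *)
pose col' x := tperm None c (col x).
have join' x y : col' x != col' y -> adj G x y.
  by rewrite (inj_eq perm_inj); apply: join.
apply: (improve Gf join') => [|b].
  suff -> : part col' None = part col c by [].
  apply/setP => x; rewrite !inE /col'.
  by rewrite -[RHS](inj_eq (@perm_inj _ (tperm None c))) tpermR.
have [x xb] := surj (tperm None c (Some b)).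
by apply: (part_big Gf join' large (v := x)); rewrite inE /col' xb tpermK.
Qed.

(** * The incidence graph placed inside the Turán graph *)

Section Incidence.
Variable K : finFieldType.

(* inl (x, y) is a point, inr (a, b) the line Y = a X + b. *)
Definition inc_vertex := (K * K + K * K)%type.

Definition incident (p l : K * K) : bool := (p.2 == l.1 * p.1 + l.2)%R.

Definition inc_rel (u v : inc_vertex) : bool :=
  match u, v with
  | inl p, inr l | inr l, inl p => incident p l
  | _, _ => false
  end.

Lemma inc_rel_sym : symmetric inc_rel.
Proof. by case=> ? []. Qed.

Lemma inc_rel_C3 u v w : inc_rel u v -> inc_rel v w -> inc_rel u w -> False.
Proof. by case: u v w => ? [] ? []. Qed.

(** Subtracting the four incidence equations gives (a - a')(x - x') = 0. *)
Lemma two_points_one_line p p' l l' :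
  incident p l -> incident p l' -> incident p' l -> incident p' l' ->
  p = p' \/ l = l'.
Proof.
case: p p' l l' => [x y] [x' y'] [a b] [a' b']; rewrite /incident /=.
move=> /eqP-> /eqP E1 /eqP-> /eqP E2.
have /eqP : ((a - a') * (x - x') = 0)%R.
  have -> : ((a - a') * (x - x') = (a * x + b) - (a * x' + b) - ((a' * x + b') - (a' * x' + b')))%R by ring.
  by rewrite E1 E2 subrr.
rewrite mulf_eq0 !subr_eq0 => /orP[]/eqP E; last by left; rewrite E.
by right; move: E1; rewrite E => /addrI->.
Qed.

Lemma inc_rel_C4 u u' v v' : inc_rel u v -> inc_rel u v' ->
  inc_rel u' v -> inc_rel u' v' -> u = u' \/ v = v'.
Proof.
case: u u' v v' => u [] u' [] v [] v' //= h1 h2 h3 h4.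
  by have [->|->] := two_points_one_line h1 h2 h3 h4; [left|right].
by have [->|->] := two_points_one_line h1 h3 h2 h4; [right|left].
Qed.

Variable n : nat.
Hypothesis n_large : 6 * #|K| ^ 2 <= n.

(** The 2q^2 points and lines are placed at multiples of 3, hence inside one class of the Turán
    graph; this is where 6q^2 at most n enters. *)
Lemma index_subproof (v : inc_vertex) : 3 * enum_rank v < n.
Proof.
have : enum_rank v < #|K| * #|K| + #|K| * #|K|.
  by rewrite -!card_prod -card_sum; apply: ltn_ord.
by move: (enum_rank v : nat) n_large => r; lia.
Qed.

Definition place v : 'I_n := Ordinal (index_subproof v).

Lemma place_inj : injective place.
Proof.
move=> u v /(congr1 val)/eqP; rewrite /= eqn_mul2l /= => /eqP.
by move/val_inj/enum_rank_inj.
Qed.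

Lemma place_mod v : place v %% 3 = 0.
Proof. by rewrite /= mulnC modnMl. Qed.

Definition placed_rel (x y : 'I_n) : bool :=
  (x %% 3 != y %% 3) || [exists u, exists v, [&& x == place u, y == place v & inc_rel u v]].

Lemma placed_rel_sym : symmetric placed_rel.
Proof.
move=> x y; rewrite /placed_rel eq_sym; congr (_ || _).
by apply/existsP/existsP => -[u /existsP[v /and3P[xu yv uv]]]; exists v;
  apply/existsP; exists u; rewrite xu yv inc_rel_sym.
Qed.

Definition dense_graph : sgraph 'I_n := graph_of placed_rel.

Lemma dense_graphP (x y : 'I_n) : adj dense_graph x y -> x %% 3 = y %% 3 ->
  exists u v, [/\ x = place u, y = place v & inc_rel u v].
Proof.
rewrite adj_graph_of; last exact: placed_rel_sym.
move=> /andP[_ /orP[/negP ne|]] E; first by rewrite E in ne.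
by case/existsP: E => u /existsP[v /and3P[/eqP xu /eqP yv uv]] _; exists u, v.
Qed.

Lemma dense_graph_free : is_free forbidden dense_graph.
Proof.
have n0 : 0 < n.
  by apply: leq_trans n_large; rewrite muln_gt0 expn_gt0; apply/orP; left;
    apply/card_gt0P; exists 0%R.
pose col (x : 'I_n) := if x %% 3 == 0 then None else Some (x %% 3 == 1).
have colE (x y : 'I_n) : col x = col y -> x %% 3 = y %% 3.
  have := ltn_pmod x (isT : 0 < 3); have := ltn_pmod y (isT : 0 < 3); rewrite /col.
  by case: (x %% 3) (y %% 3) => [|[|[|]]] // [|[|[|]]].
have inner (x y : 'I_n) b : col x = Some b -> col y = Some b -> adj dense_graph x y -> False.
  move=> xb yb /dense_graphP[|u [v [xu _ _]]]; first by apply: colE; rewrite xb.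
  by move: xb; rewrite /col xu place_mod.
have NP x y : col x = None -> col y = None -> adj dense_graph x y ->
    exists u v, [/\ x = place u, y = place v & inc_rel u v].
  by move=> xN yN /dense_graphP; apply; apply: colE; rewrite xN.
(* The residue classes 1 and 2 span no edges, so one arbitrary vertex can serve as both centres. *)
apply: (@template_free _ _ col (fun=> Ordinal n0)); split.
- move=> x y z xN yN zN /(NP _ _ xN yN)[u [v [E1 E2 uv]]].
  move=> /(NP _ _ yN zN)[v1 [w [E3 E4 vw]]].
  move=> /(NP _ _ xN zN)[u1 [w1 [E5 E6 uw]]].
  have ? : v1 = v by apply: place_inj; rewrite -E3.
  have ? : u1 = u by apply: place_inj; rewrite -E5.
  have ? : w1 = w by apply: place_inj; rewrite -E6.
  by subst v1 u1 w1; apply: inc_rel_C3 uv vw uw.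
- move=> x x' y y' xN x'N yN y'N xx' yy'.
  move=> /(NP _ _ xN yN)[u [v [E1 E2 uv]]].
  move=> /(NP _ _ xN y'N)[u1 [v' [E3 E4 uv']]].
  move=> /(NP _ _ x'N yN)[u' [v1 [E5 E6 u'v]]].
  move=> /(NP _ _ x'N y'N)[u2 [v2 [E7 E8 u'v']]].
  have ? : u1 = u by apply: place_inj; rewrite -E3.
  have ? : v1 = v by apply: place_inj; rewrite -E6.
  have ? : u2 = u' by apply: place_inj; rewrite -E7.
  have ? : v2 = v' by apply: place_inj; rewrite -E8.
  subst u1 v1 u2 v2.
  case: (inc_rel_C4 uv uv' u'v u'v') => E.
    by rewrite E1 E5 E eqxx in xx'.
  by rewrite E2 E4 E eqxx in yy'.
- by move=> b x y xb yb /(inner _ _ _ xb yb).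
- move=> b x xb; rewrite eq_card0 // => y; rewrite !inE.
  by apply/negP => /andP[/eqP yb /(inner _ _ _ xb yb)].
- by rewrite adj_irrefl.
Qed.

Lemma dense_graph_edges : turan 3 n + #|K| ^ 3 <= #|edges dense_graph|.
Proof.
(* An incidence is determined by a line (a, b) and the abscissa x of a point on it, which gives q^3
   of them. *)
pose f (t : K * K * K) : {set 'I_n} :=
  let: (a, b, x) := t in [set place (inl (x, (a * x + b)%R)); place (inr (a, b))].
have fI : injective f.
  move=> [[a b] x] [[a' b'] x'] E.
  have: place (inr (a, b)) \in f (a', b', x') by rewrite -E set22.
  have: place (inl (x, (a * x + b)%R)) \in f (a', b', x') by rewrite -E set21.
  by rewrite !inE !(inj_eq place_inj) => /orP[]/eqP // [-> _] /orP[]/eqP // [-> ->].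
have <- : #|[set f t | t : K * K * K]| = #|K| ^ 3.
  by rewrite card_imset // !card_prod -mulnA.
set B := [set f t | t : K * K * K]; set T := edges (turan_graph 3 n).
have Tsym : symmetric (fun x y : 'I_n => x %% 3 != y %% 3).
  by move=> x y; rewrite eq_sym.
have dis : [disjoint T & B].
  apply/pred0P => e /=; apply/negP => /andP[/edgesP[x [y [xy ->]]] /imsetP[[[a b] z] _]].
  move: xy; rewrite adj_graph_of // => /andP[_ xy] /= E.
  have mod0 u : u \in [set x; y] -> u %% 3 = 0.
    by rewrite E => /set2P[]->; rewrite place_mod.
  by rewrite !mod0 ?set21 ?set22 in xy.
have sub : T :|: B \subset edges dense_graph.
  apply/subsetP => e /setUP[/edgesP[x [y [+ ->]]]|/imsetP[[[a b] z] _ ->]].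
    rewrite adj_graph_of // => /andP[xy ne].
    change (adj dense_graph x y); rewrite adj_graph_of; last exact: placed_rel_sym.
    by rewrite xy /placed_rel ne.
  change (adj dense_graph (place (inl (z, (a * z + b)%R))) (place (inr (a, b)))).
  rewrite adj_graph_of; last exact: placed_rel_sym.
  rewrite (inj_eq place_inj) /placed_rel; apply/orP; right.
  by apply/existsP; exists (inl (z, (a * z + b)%R)); apply/existsP; exists (inr (a, b)); rewrite !eqxx /= /incident /=.
rewrite /turan -/T; apply: leq_trans (subset_leq_card sub).
by rewrite cardsU (disjoint_setI0 dis) cards0 subn0.
Qed.

End Incidence.

(** * Numerical bounds, and extremal graphs are not joins *)

(** Here q = 2^k, where 4^k = q^2 is the largest power of 4 that is at most n/6. *)
Lemma exists_dense_free n : 24 <= n -> exists q (G : sgraph 'I_n),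
  [/\ 0 < q, n < 24 * q ^ 2, is_free forbidden G & turan 3 n + q ^ 3 <= #|edges G|].
Proof.
move=> n24; pose k := trunc_log 4 (n %/ 6).
have n6 : 4 <= n %/ 6 by rewrite leq_divRL.
have k1 : 0 < k by rewrite trunc_log_gt0 /= n6.
have /andP[lo hi] := trunc_log_bounds (isT : 1 < 4) (leq_trans (isT : 0 < 4) n6).
have [K _ Kq] := pPrimePowerField (isT : prime 2) k1.
have q2 : (2 ^ k) ^ 2 = 4 ^ k by rewrite -expnM mulnC expnM.
have [lo' hi'] : 6 * #|K| ^ 2 <= n /\ n < 24 * (2 ^ k) ^ 2.
  rewrite Kq q2; move: lo hi; rewrite -/k expnS.
  by rewrite leq_divRL // ltn_divLR //; lia.
exists (2 ^ k), (dense_graph lo'); split=> //; first by rewrite expn_gt0.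
  exact: dense_graph_free.
by rewrite -Kq; apply: dense_graph_edges.
Qed.

(** A residue class modulo 3 has at most n/3 + 1 elements, so every degree is at least n - n/3 -
    1. *)
Lemma turan_ge n : 2 * n ^ 2 <= 6 * turan 3 n + 3 * n.
Proof.
have Tsym : symmetric (fun x y : 'I_n => x %% 3 != y %% 3).
  by move=> x y; rewrite eq_sym.
have small (r : nat) : #|[set y : 'I_n | y %% 3 == r]| <= (n %/ 3).+1.
  have lt (y : 'I_n) : y %/ 3 < (n %/ 3).+1 by rewrite ltnS leq_div2r // ltnW.
  rewrite -[X in _ <= X]card_ord -(card_in_imset (f := fun y => Ordinal (lt y))).
    exact: max_card.
  move=> x y; rewrite !inE => /eqP xr /eqP yr [xy].
  by apply: val_inj; rewrite /= (divn_eq x 3) (divn_eq y 3) xy xr yr.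
have deg (x : 'I_n) : n - (n %/ 3).+1 <= #|nbhd (turan_graph 3 n) setT x|.
  have -> : nbhd (turan_graph 3 n) setT x = ~: [set y : 'I_n | y %% 3 == x %% 3].
    apply/setP => y; rewrite !inE adj_graph_of // [x %% 3 == _]eq_sym.
    by case: (eqVneq x y) => [->|]; rewrite ?eqxx.
  by rewrite cardsCs setCK card_ord leq_sub2l.
have : n * (n - (n %/ 3).+1) <= 2 * turan 3 n.
  rewrite -handshake /arcs -{1}(card_ord n) -cardsT -sum_nat_const.
  by apply: leq_sum.
have m3 : 3 * (n %/ 3) <= n by rewrite mulnC leq_trunc_div.
move: (n %/ 3) m3 (turan 3 n) => m m3 t H.
have : n * (2 * n) <= n * (3 * (n - m.+1) + 3) by rewrite leq_mul2l; apply/orP; right; lia.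
rewrite mulnDr (mulnCA n 3) (mulnCA n 2) expnS expn1; lia.
Qed.

Lemma ex_num_ge n L (G : sgraph 'I_n) : is_free L G -> #|edges G| <= ex_num n L.
Proof. by move=> Gf; rewrite /ex_num; apply: leq_bigmax_cond. Qed.

Lemma extremal_not_join n (G : sgraph 'I_n) (col : 'I_n -> option bool) :
  24 * 612 ^ 2 <= n -> G \in EX n forbidden -> (forall c, exists x, col x = c) ->
  (forall x y, col x != col y -> adj G x y) -> False.
Proof.
move=> n_large; rewrite inE => /andP[Gf /eqP Gmax] surj join.
have [|q [D [q0 nq Df De]]] := @exists_dense_free n; first by apply: leq_trans n_large; lia.
(* The constant satisfies 6 * 612 = 153 * 24, so 6q^3 exceeds 153 n; this covers the 150 n required
   and the 3n lost in [turan_ge]. *)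
have q612 : 612 <= q.
  rewrite -(@leq_exp2r _ _ 2) // -(leq_pmul2l (isT : 0 < 24)).
  exact: leq_trans n_large (ltnW nq).
have [|G' [G'f]] := join_not_extremal Gf surj join; last first.
  by rewrite Gmax ltnNge ex_num_ge.
have := ex_num_ge Df; rewrite -Gmax card_ord; have := turan_ge n.
have : 612 * q ^ 2 <= q ^ 3 by rewrite (expnS q 2) leq_mul2r q612 orbT.
move: De nq; move: (turan 3 n) (#|edges D|) (#|edges G|) (q ^ 3) (q ^ 2) (n ^ 2) => *.
lia.
Qed.

Lemma adj_graph_ofI (V : finType) (r : rel V) x y :
  x != y -> r x y -> adj (graph_of r) x y.
Proof.
move=> xy rxy; rewrite /adj inE; apply/existsP; exists x.
by apply/existsP; exists y; rewrite xy rxy eqxx.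
Qed.

(** Vertices in different components of the complement are adjacent in [G]. Two components get a
    colour of their own, and all the others share the third. *)
Lemma compl_components_join (V : finType) (G : sgraph V) :
  2 < num_components (compl_graph G) ->
  exists col : V -> option bool, (forall c, exists x, col x = c) /\
    (forall x y, col x != col y -> adj G x y).
Proof.
set e := adj (compl_graph G); have cs : connect_sym e.
  by apply: sym_connect_sym => x y; apply: adj_sym.
move=> /card_gt2P[r1 [r2 [r3 [[]]]]]; rewrite !inE !andbT.
move=> /eqP root1 /eqP root2 /eqP root3 [r12 r23 r31].
have nconn x y : fingraph.root e x = x -> fingraph.root e y = y -> x != y -> connect e x y = false.
  by move=> Ex Ey xy; rewrite -(root_connect cs) Ex Ey; apply/negbTE.
exists (fun x => if connect e r1 x then None else Some (connect e r2 x)); split.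
  move=> [[]|]; [exists r2 | exists r3 | exists r1]; rewrite ?connect0 //.
    by rewrite nconn.
  by rewrite !nconn // eq_sym.
move=> x y; apply: contraNT => xy; have [->|ne] := eqVneq x y; first by [].
have exy : connect e x y by apply: connect1; apply: adj_graph_ofI.
by rewrite !(same_connect_r cs exy).
Qed.

Lemma isomorphic_join_coloring (V : finType) (G : sgraph V)
    (W : 'I_3 -> finType) (H : forall i, sgraph (W i)) :
  (forall i, 0 < #|W i|) -> isomorphic G (complete_join H) ->
  exists col : V -> option bool, (forall c, exists x, col x = c) /\
    (forall x y, col x != col y -> adj G x y).
Proof.
move=> W0 [f [[g fK gK] fadj]].
pose part_of (i : 'I_3) := if val i == 0 then None else Some (val i == 1).
exists (fun x => part_of (tag (f x))); split=> [c|x y cxy].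
  have [i <-] : exists i, part_of i = c.
    by case: c => [[]|]; [exists (@Ordinal 3 1 isT) | exists (@Ordinal 3 2 isT)
                        | exists (@Ordinal 3 0 isT)].
  have /card_gt0P[w _] := W0 i.
  by exists (g (Tagged (fun i => W i : Type) w)); rewrite gK.
have ne : tag (f x) != tag (f y) by apply: contraNneq cxy => ->.
rewrite fadj; apply: adj_graph_ofI; last by rewrite ne.
by apply: contraNneq ne => ->.
Qed.

(** * The real exponent and the conclusion *)

Local Open Scope ring_scope.

Lemma powR_three_halves_le (R : realType) (n q : nat) : (n < 24 * q ^ 2)%N ->
  (n%:R : R) `^ (3 / 2) <= 125 * (q ^ 3)%:R.
Proof.
(* Since 24 < 5^2, n is at most (5q)^2, whose power 3/2 is (5q)^3. *)
move=> nq; have -> : 125 * (q ^ 3)%:R = (((5 * q) ^ 2)%:R : R) `^ (3 / 2).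
  have -> : ((5 * q) ^ 2)%:R = ((5 * q)%:R : R) `^ 2%:R.
    by rewrite powR_mulrn // natrX.
  rewrite -powRrM mulrCA divff ?pnatr_eq0 // mulr1 powR_mulrn //.
  by rewrite -natrX expnMn natrM.
apply: ge0_ler_powR; rewrite ?nnegrE ?ler0n ?divr_ge0 //.
by rewrite ler_nat expnMn; lia.
Qed.

Theorem theorem1p2 (R : realType) :
  exists (L : seq graph) (c : R) (N : nat),
    [/\ (0 < size L)%N,
        0 < c,
        p_family L = 3%N &
        forall n : nat, (N <= n)%N ->
          [/\ (turan 3 n)%:R + c * n%:R `^ (3 / 2) < (ex_num n L)%:R,
              forall G : sgraph 'I_n, G \in EX n L ->
                (num_components (compl_graph G) <= 2)%N &
              forall G : sgraph 'I_n, G \in EX n L ->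
                ~ (exists (V : 'I_3 -> finType) (H : forall i, sgraph (V i)),
                     (forall i, (0 < #|V i|)%N) /\
                     isomorphic G (complete_join H))]].
Proof.
(* With 1/250 the term c n^(3/2) is at most q^3/2, hence strictly below the gain q^3. *)
exists forbidden, (1 / 250), (24 * 612 ^ 2)%N; split=> //.
- by rewrite divr_gt0.
- exact: p_forbidden.
move=> n n_large; split.
- have [|q [D [q0 nq Df De]]] := @exists_dense_free n.
    by apply: leq_trans n_large; lia.
  have := leq_trans De (ex_num_ge Df); rewrite -(ler_nat R) natrD.
  have := powR_three_halves_le R nq.
  have : (0 : R) < (q ^ 3)%:R by rewrite ltr0n expn_gt0 q0.
  lra.
- move=> G GE; rewrite leqNgt; apply/negP => /compl_components_join[col [surj join]].
  exact: extremal_not_join n_large GE surj join.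
- move=> G GE [V [H [V0 iso]]].
  have [col [surj join]] := isomorphic_join_coloring V0 iso.
  exact: extremal_not_join n_large GE surj join.
Qed.
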